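(* For all simplicial sets $X$, $Y$, $Z$ the following identities of maps hold: $$H_{X\times Y,Z}\,\nabla_{X,Y\times Z}=\nabla_{X,Y\times Z}\,(1\otimes H_{Y,Z})\colon C(X)\otimes C(Y\times Z)\to C(X\times Y\times Z),$$ $$H_{X,Y\times Z}\,\nabla_{X\times Y,Z}=\nabla_{X\times Y,Z}\,(H_{X,Y}\otimes1)\colon C(X\times Y)\otimes C(Z)\to C(X\times Y\times Z).$$
   Context: $\Bbbk$ is a commutative ring with unit; $C(X)$ is the normalized chain complex of a simplicial set $X$ over $\Bbbk$. The Koszul sign rule is used, e.g. $(1\otimes h)(x\otimes c)=(-1)^{|h||x|}x\otimes h(c)$. For a simplex $x$ write $\partial_p^qx=\partial_p\partial_{p+1}\cdots\partial_qx$ for $p\le q$ and $\partial_p^{p-1}x=x$. For a set $\alpha=\{\alpha_1<\dots<\alpha_p\}$ of non-negative integers write $s_\alpha x=s_{\alpha_p}\cdots s_{\alpha_1}x$, $s_\emptyset x=x$, and $\alpha+m=\{\alpha_1+m,\dots,\alpha_p+m\}$. A $(p,q)$-shuffle $(\alpha,\beta)\vdash(p,q)$ is a partition of $\{0,\dots,p+q-1\}$ into sets $\alpha,\beta$ of sizes $p,q$; $(-1)^{(\alpha,\beta)}$ is the sign of the permutation $(\alpha_1<\dots<\alpha_p,\beta_1<\dots<\beta_q)$. The shuffle map is $\nabla_{X,Y}\colon C(X)\otimes C(Y)\to C(X\times Y)$, $\nabla(x\otimes y)=\sum_{(\alpha,\beta)\vdash(p,q)}(-1)^{(\alpha,\beta)}(s_\beta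 x,s_\alpha y)$ for $p=|x|$, $q=|y|$. The Eilenberg--Mac Lane homotopy $H_{X,Y}\colon C(X\times Y)\to C(X\times Y)$ (degree $+1$) is, for $(x,y)\in X_n\times Y_n$ and with $m=n-p-q$, $$H(x,y)=\sum_{p,q\ge0,\;p+q<n}\ \sum_{(\alpha,\beta)\vdash(p+1,q)}(-1)^{m+1+(\alpha,\beta)}\bigl(s_{\beta+m}\,s_{m-1}\,\partial_{n-q+1}^nx,\ s_{\alpha+m}\,\partial_m^{n-q-1}y\bigr).$$ $H_{X\times Y,Z}$ and $H_{X,Y\times Z}$ (and similarly the $\nabla$ maps) arise from regarding $X\times Y\times Z$ as $(X\times Y)\times Z$ and $X\times(Y\times Z)$, respectively. *)

(* Defs.v *)
From HB Require Import structures.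
From mathcomp Require Import all_boot all_algebra all_fingroup.
From mathcomp Require Import generic_quotient ring_quotient.
From mathcomp Require Import zify.
From mathcomp Require Import boolp classical_sets functions cardinality fsbigop.
Set Implicit Arguments.
Unset Strict Implicit.
Unset Printing Implicit Defensive.
Import GRing.Theory.
Local Open Scope ring_scope.
Local Open Scope classical_set_scope.

Section FreeModule.
Variables (k : comPzRingType) (T : choiceType).

Definition finsupp : {pred T -> k^o} :=
  fun f => `[< finite_set (f @^-1` [set~ 0]) >].

Lemma finsupp_submod : submod_closed finsupp.
Proof.
split=> [|a f g /asboolP Ff /asboolP Fg]; apply/asboolP.
  by apply: sub_finite_set (finite_set0 T) => x /=; apply.
apply: sub_finite_set (_ : finite_set (f @^-1` [set~ 0] `|` g @^-1` [set~ 0])).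
  move=> x /= fgx; apply: contrapT => /not_orP [/contrapT f0 /contrapT g0].
  apply: fgx; rewrite /= [LHS](_ : _ = a *: f x + g x) // f0 g0.
  by rewrite scaler0 addr0.
by rewrite finite_setU.
Qed.

HB.instance Definition _ :=
  GRing.isSubmodClosed.Build k (T -> k^o) finsupp finsupp_submod.

Record freemod := FreeMod { free_val :> T -> k^o; _ : free_val \in finsupp }.

HB.instance Definition _ := [isSub for free_val].
HB.instance Definition _ := [Choice of freemod by <:].
HB.instance Definition _ := [SubChoice_isSubLmodule of freemod by <:].

Lemma free_val_fin (f : freemod) : finite_set ((f : T -> k^o) @^-1` [set~ 0]).
Proof. by case: f => f /= /asboolP. Qed.

Lemma single_fin (x : T) : (fun y => (y == x)%:R : k^o) \in finsupp.
Proof.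
apply/asboolP; apply: sub_finite_set (finite_set1 x) => y /=.
by case: eqP => // _ /(_ erefl).
Qed.

Definition single (x : T) : freemod := FreeMod (single_fin x).

Section Lift.
Variables (V : lmodType k) (g : T -> V).

Definition free_lift (f : freemod) : V := \sum_(x \in [set: T]) f x *: g x.

Lemma free_lift_seq (f : freemod) (s : seq T) : uniq s ->
  (forall x, x \notin s -> f x = 0) -> free_lift f = \sum_(x <- s) f x *: g x.
Proof.
move=> us fs; rewrite /free_lift.
rewrite -(fsbig_fwiden s [set` s]) //; last by move=> x [].
apply/esym/fsbig_widen => // x [_ /= /negP /fs ->].
by rewrite scale0r.
Qed.

Lemma free_supp (f : freemod) : exists2 s : seq T, uniq s & forall x, x \notin s -> f x = 0.
Proof.
exists (finite_support 0 [set: T] (f : T -> k^o)) => [|x]; first exact: finite_support_uniq.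
have Ff := free_val_fin f.
rewrite in_finite_support ?setTI // notin_setE /=.
exact: contrapT.
Qed.

Lemma free_lift_linear : linear free_lift.
Proof.
move=> a f h.
have [s us fs] := free_supp f; have [t ut ht] := free_supp h.
pose r := undup (s ++ t).
have ur : uniq r by apply: undup_uniq.
have fr x : x \notin r -> f x = 0.
  by rewrite mem_undup mem_cat negb_or => /andP[/fs].
have hr x : x \notin r -> h x = 0.
  by rewrite mem_undup mem_cat negb_or => /andP[_ /ht].
rewrite (free_lift_seq ur fr) (free_lift_seq ur hr) (free_lift_seq (s := r)) //.
  by rewrite scaler_sumr -big_split; apply: eq_bigr => x _ /=; rewrite scalerA -scalerDl.
by move=> x xr; rewrite [LHS](_ : _ = a *: f x + h x) // fr // hr // scaler0 addr0.
Qed.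

HB.instance Definition _ :=
  GRing.isLinear.Build k freemod V _ free_lift free_lift_linear.

Lemma free_lift_single x : free_lift (single x) = g x.
Proof.
rewrite (free_lift_seq (s := [:: x])) //.
  by rewrite big_seq1 /= eqxx scale1r.
by move=> y; rewrite inE /= => /negbTE ->.
Qed.

End Lift.

Lemma free_lift_id (f : freemod) : free_lift single f = f.
Proof.
have [s us fs] := free_supp f.
rewrite (free_lift_seq _ us fs); apply: val_inj; apply: funext => y /=.
have -> : val (\sum_(x <- s) f x *: single x) = \sum_(x <- s) f x *: val (single x).
  by rewrite linear_sum; apply: eq_bigr => x _; rewrite linearZ.
rewrite fct_sumE /=.
have [ys|ys] := boolP (y \in s); last first.
  rewrite fs // big_seq big1 // => x xs.
  rewrite [LHS](_ : _ = f x * (y == x)%:R) //.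
  by case: eqP => [yx|_]; rewrite ?mulr0 //; move: ys; rewrite yx xs.
rewrite (bigD1_seq y) //= big1 ?addr0 => [|x xy].
  by rewrite [LHS](_ : _ = f y * (y == y)%:R) // eqxx mulr1.
rewrite [LHS](_ : _ = f x * (y == x)%:R) //.
by rewrite eq_sym (negbTE xy) mulr0.
Qed.

End FreeModule.

Section SpanQuotient.
Variables (k : comPzRingType) (V : lmodType k) (S : set V).

Definition lspan : {pred V} := fun v =>
  `[< forall W : {pred V}, submod_closed W -> (forall u, S u -> u \in W) -> v \in W >].

Lemma span_submod : submod_closed lspan.
Proof.
split=> [|a u v /asboolP Su /asboolP Sv]; apply/asboolP => W WV SW.
  by case: WV.
by case: (WV) => _ /(_ a); apply; [exact: Su|exact: Sv].
Qed.

HB.instance Definition _ := GRing.isSubmodClosed.Build k V lspan span_submod.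

Lemma sub_span u : S u -> u \in lspan.
Proof. by move=> Su; apply/asboolP => W _; apply. Qed.

Definition quotmod := Quotient.quot (lspan : zmodClosed V).
HB.instance Definition _ := GRing.Zmodule.on quotmod.

Definition qproj (v : V) : quotmod := \pi_(quotmod)%qT v.

Lemma proj_eq u v : (qproj u == qproj v) = (u - v \in lspan).
Proof. by rewrite /qproj Quotient.idealrBE. Qed.

Lemma projB : {morph qproj : u v / u - v}.
Proof. by move=> u v; rewrite /qproj; apply: raddfB. Qed.
Lemma projD : {morph qproj : u v / u + v}.
Proof. by move=> u v; rewrite /qproj; apply: raddfD. Qed.

Lemma projP (q : quotmod) : exists v, q = qproj v.
Proof. by exists (repr q); rewrite /qproj reprK. Qed.

Definition quotmod_scale (a : k) (q : quotmod) : quotmod := qproj (a *: repr q).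

Lemma proj_scale a v : qproj (a *: v) = quotmod_scale a (qproj v).
Proof.
apply/eqP; rewrite proj_eq -scalerBr rpredZ // -proj_eq.
by apply/eqP; rewrite {2}/qproj reprK.
Qed.

Lemma quotmod_scaleA a b q :
  quotmod_scale a (quotmod_scale b q) = quotmod_scale (a * b) q.
Proof. by have [v ->] := projP q; rewrite -!proj_scale scalerA. Qed.
Lemma quotmod_scale1 : left_id 1 quotmod_scale.
Proof. by move=> q; have [v ->] := projP q; rewrite -!proj_scale scale1r. Qed.
Lemma quotmod_scaleDr : right_distributive quotmod_scale +%R.
Proof.
move=> a p q; have [u ->] := projP p; have [v ->] := projP q.
by rewrite -projD -!proj_scale -projD scalerDr.
Qed.
Lemma quotmod_scaleDl q : {morph quotmod_scale^~ q : a b / a + b}.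
Proof. by move=> a b; have [v ->] := projP q; rewrite -!proj_scale -projD scalerDl. Qed.

HB.instance Definition _ := GRing.Zmodule_isLmodule.Build k quotmod
  quotmod_scaleA quotmod_scale1 quotmod_scaleDr quotmod_scaleDl.

Lemma proj_linear : linear qproj.
Proof. by move=> a u v; rewrite projD proj_scale. Qed.
HB.instance Definition _ := GRing.isLinear.Build k V quotmod _ qproj proj_linear.

Lemma proj0 u : S u -> qproj u = 0.
Proof. by move=> Su; apply/eqP; rewrite -(linear0 qproj) proj_eq subr0 sub_span. Qed.

Section Lift.
Variables (W : lmodType k) (f : {linear V -> W}) (f0 : forall u, S u -> f u = 0).

Lemma quotmod_lift_span u : u \in lspan -> f u = 0.
Proof.
move=> /asboolP/(_ (fun v => f v == 0)) fu; apply/eqP/fu.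
  split=> [|a v w]; rewrite !unfold_in ?linear0 // linearP => /eqP -> /eqP ->.
  by rewrite scaler0 addr0.
by move=> v /f0; rewrite unfold_in => ->.
Qed.

Definition quotmod_lift of (forall u, S u -> f u = 0) := fun q : quotmod => f (repr q).
Local Notation lift := (quotmod_lift f0).

Lemma quotmod_lift_proj u : lift (qproj u) = f u.
Proof.
apply/eqP; rewrite -subr_eq0 -linearB; apply/eqP/quotmod_lift_span.
by rewrite -proj_eq {1}/qproj reprK.
Qed.

Lemma quotmod_lift_linear : linear lift.
Proof.
move=> a p q; have [u ->] := projP p; have [v ->] := projP q.
by rewrite -linearP !quotmod_lift_proj linearP.
Qed.
HB.instance Definition _ :=
  GRing.isLinear.Build k quotmod W _ lift quotmod_lift_linear.
End Lift.
End SpanQuotient.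

(* The tensor product of two modules, as the quotient of the free module on
   pairs by the bilinearity relations. *)
Section Tensor.
Variables (k : comPzRingType) (A B : lmodType k).

Inductive tens_rel : set (freemod k {classic (A * B)}) :=
| TensRelL a (u v : A) (w : B) :
    tens_rel (single k ((a *: u + v, w) : {classic _})
              - (a *: single k ((u, w) : {classic _}) + single k ((v, w) : {classic _})))
| TensRelR a (u : A) (v w : B) :
    tens_rel (single k ((u, a *: v + w) : {classic _})
              - (a *: single k ((u, v) : {classic _}) + single k ((u, w) : {classic _}))).

Definition tensor := quotmod tens_rel.
HB.instance Definition _ := GRing.Lmodule.on tensor.

Definition tens (u : A) (v : B) : tensor := qproj _ (single k ((u, v) : {classic _})).

Lemma tensDl a u v w : tens (a *: u + v) w = a *: tens u w + tens v w.
Proof.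
apply/eqP; rewrite -subr_eq0 /tens -linearP -linearB; apply/eqP/proj0.
exact: TensRelL.
Qed.

Lemma tensDr a u v w : tens u (a *: v + w) = a *: tens u v + tens u w.
Proof.
apply/eqP; rewrite -subr_eq0 /tens -linearP -linearB; apply/eqP/proj0.
exact: TensRelR.
Qed.

Section Lift.
Variables (V : lmodType k) (f : A -> B -> V).
Hypotheses (fl : forall w, linear (f^~ w)) (fr : forall u, linear (f u)).

Lemma tens_lift0 t : tens_rel t -> free_lift (fun p : {classic A * B} => f p.1 p.2) t = 0.
Proof.
case=> [a u v w|a u v w]; rewrite linearB linearP /= !free_lift_single /=.
  by rewrite fl subrr.
by rewrite fr subrr.
Qed.

Definition tens_lift : tensor -> V := quotmod_lift tens_lift0.
HB.instance Definition _ := GRing.Linear.on tens_lift.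

Lemma tens_liftE u v : tens_lift (tens u v) = f u v.
Proof. by rewrite /tens_lift /tens quotmod_lift_proj /= free_lift_single. Qed.
End Lift.

(* Elementary tensors span the tensor product. *)
Lemma tensor_ext (V : lmodType k) (f g : {linear tensor -> V}) :
  (forall u v, f (tens u v) = g (tens u v)) -> f =1 g.
Proof.
move=> fg t; have [r ->] := projP t; rewrite -(free_lift_id r).
have [s us rs] := free_supp r; rewrite (free_lift_seq _ us rs) !linear_sum /=.
by apply: eq_bigr => -[u v] _; rewrite !linearZ /=; congr (_ *: _); apply: fg.
Qed.
End Tensor.

Section TensorMap.
Variables (k : comPzRingType) (A B A' B' : lmodType k).
Variables (f : {linear A -> A'}) (g : {linear B -> B'}).

Lemma tens_map_linl w : linear (fun u => tens (f u) (g w)).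
Proof. by move=> a u v; rewrite linearP tensDl. Qed.
Lemma tens_map_linr u : linear (fun w => tens (f u) (g w)).
Proof. by move=> a v w; rewrite linearP tensDr. Qed.

Definition tens_map : tensor A B -> tensor A' B' :=
  tens_lift tens_map_linl tens_map_linr.
HB.instance Definition _ := GRing.Linear.on tens_map.

Lemma tens_mapE u v : tens_map (tens u v) = tens (f u) (g v).
Proof. exact: tens_liftE. Qed.
End TensorMap.

(* The simplex category: monotone maps [0..m] -> [0..n]. *)
Section Delta.
Local Open Scope nat_scope.

Definition monob m n (f : {ffun 'I_m.+1 -> 'I_n.+1}) :=
  [forall i : 'I_m.+1, forall j : 'I_m.+1, (i <= j) ==> (f i <= f j)].

Record dhom m n := DHom { dfun :> {ffun 'I_m.+1 -> 'I_n.+1}; _ : monob dfun }.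
HB.instance Definition _ m n := [isSub for @dfun m n].

Lemma dhomP m n (f : dhom m n) (i j : 'I_m.+1) : i <= j -> f i <= f j.
Proof. by case: f => f /= /forallP/(_ i)/forallP/(_ j)/implyP. Qed.

Lemma dhom_eq m n (f g : dhom m n) : (forall i, f i = g i :> nat) -> f = g.
Proof. by move=> fg; apply/val_inj/ffunP => i; apply/val_inj/fg. Qed.

Lemma monobP m n (f : 'I_m.+1 -> 'I_n.+1) :
  (forall i j : 'I_m.+1, i <= j -> f i <= f j) -> monob (finfun f).
Proof.
move=> fm; apply/forallP => i; apply/forallP => j; apply/implyP => ij.
by rewrite !ffunE fm.
Qed.

Definition did n : dhom n n := DHom (@monobP n n id (fun i j ij => ij)).

Definition dcomp l m n (f : dhom m n) (g : dhom l m) : dhom l n :=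
  DHom (@monobP l n (fun i => f (g i)) (fun i j ij => dhomP f (dhomP g ij))).

Lemma lift_mono n (i : 'I_n.+2) (j l : 'I_n.+1) : j <= l -> lift i j <= lift i l.
Proof. by rewrite /= leq_bump2. Qed.

(* The injection missing i. *)
Definition coface n (i : 'I_n.+2) : dhom n n.+1 := DHom (monobP (lift_mono i)).

Lemma unbump_lt n (i : 'I_n.+1) (j : 'I_n.+2) : unbump i j < n.+1.
Proof.
rewrite /unbump; case: (ltnP i j) => ij; first by rewrite ltn_subLR ?(leq_trans _ ij) // add1n.
by rewrite subn0 (leq_ltn_trans ij).
Qed.

Lemma codegen_mono n (i : 'I_n.+1) (j l : 'I_n.+2) : j <= l ->
  Ordinal (unbump_lt i j) <= Ordinal (unbump_lt i l).
Proof. by move=> jl /=; rewrite /unbump; lia. Qed.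

(* The surjection taking the value i twice. *)
Definition codegen n (i : 'I_n.+1) : dhom n.+1 n := DHom (monobP (@codegen_mono n i)).
End Delta.

(* A simplicial set is a contravariant functor from the simplex category to
   sets. *)
Record sset := SSet {
  simplices :> nat -> Type;
  sact : forall m n, dhom m n -> simplices n -> simplices m;
  sact_id : forall n x, sact (did n) x = x;
  sact_comp : forall l m n (f : dhom m n) (g : dhom l m) x,
    sact (dcomp f g) x = sact g (sact f x) }.

Definition face (X : sset) n (i : 'I_n.+2) (x : X n.+1) : X n := sact (coface i) x.
Definition degen (X : sset) n (i : 'I_n.+1) (x : X n) : X n.+1 := sact (codegen i) x.

Definition sprod (X Y : sset) : sset.
refine (@SSet (fun n => X n * Y n)%type (fun m n f xy => (sact f xy.1, sact f xy.2)) _ _).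
- by move=> n [x y]; rewrite !sact_id.
- by move=> l m n f g [x y]; rewrite !sact_comp.
Defined.

Record smap (X Y : sset) := SMap {
  smap_fun :> forall n, X n -> Y n;
  smap_act : forall m n (f : dhom m n) x, smap_fun (sact f x) = sact f (smap_fun x) }.

Definition sassoc (X Y Z : sset) : smap (sprod X (sprod Y Z)) (sprod (sprod X Y) Z).
by exists (fun n t => ((t.1, t.2.1), t.2.2)).
Defined.

Definition sassocV (X Y Z : sset) : smap (sprod (sprod X Y) Z) (sprod X (sprod Y Z)).
by exists (fun n t => (t.1.1, (t.1.2, t.2))).
Defined.

(* Simplices of all dimensions. Operators are indexed by natural numbers on this
   type, so that iterated operators need no transport along equalities of
   dimensions. *)
Definition simp (X : sset) := {n : nat & X n}.

Section TotalSimplices.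
Variable X : sset.
Local Open Scope nat_scope.

(* For 0 <= i <= dim s and dim s > 0 this is the i-th face of s; all other
   values are irrelevant. *)
Definition sface (i : nat) (s : simp X) : simp X :=
  let: existT n x := s in
  match n return X n -> simp X with
  | 0 => fun x => existT _ 0 x
  | n'.+1 => fun x => existT _ n' (face (inord i) x)
  end x.

(* For 0 <= i <= dim s this is the i-th degeneracy of s; all other values are
   irrelevant. *)
Definition sdegen (i : nat) (s : simp X) : simp X :=
  existT _ (tag s).+1 (degen (inord i) (tagged s)).

(* d_p d_(p+1) ... d_q s, that is, s if q < p *)
Definition sfaces (p q : nat) (s : simp X) : simp X :=
  foldr sface s (index_iota p q.+1).

(* s_(a_p) ... s_(a_1) s for a = a_1, ..., a_p *)
Definition sdegens (a : seq nat) (s : simp X) : simp X :=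
  foldl (fun t i => sdegen i t) s a.

Definition degenerate (s : simp X) : Prop :=
  exists n (i : 'I_n.+1) (x : X n), s = existT _ n.+1 (degen i x).

(* t is the pullback of s along a monotone map with underlying function g *)
Definition pullback (s : simp X) (g : nat -> nat) (n : nat) (t : simp X) : Prop :=
  exists2 f : dhom n (tag s), t = existT _ n (sact f (tagged s)) &
    forall j, f j = g j :> nat.

Lemma pullback_id s : pullback s id (tag s) s.
Proof.
by exists (did _) => [|j]; rewrite ?sact_id ?ffunE //; case: s.
Qed.

Lemma pullback_ext s g h n t : (forall j, j <= n -> g j = h j) ->
  pullback s g n t -> pullback s h n t.
Proof. by move=> gh [f -> fg]; exists f => // j; rewrite fg gh // -ltnS. Qed.

Lemma pullback_tag s g n t : pullback s g n t -> tag t = n.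
Proof. by case=> f ->. Qed.

Lemma pullback_uniq s g n t t' : pullback s g n t -> pullback s g n t' -> t = t'.
Proof.
case=> f -> fg [f' -> fg']; congr (existT _ _ (sact _ _)).
by apply: dhom_eq => j; rewrite fg fg'.
Qed.

Lemma pullback_degen s g n t i : i <= n -> pullback s g n t ->
  pullback s (fun j => g (unbump i j)) n.+1 (sdegen i t).
Proof.
move=> ni [f -> fg]; exists (dcomp f (codegen (inord i))) => [|j].
  by rewrite sact_comp.
by rewrite ffunE fg ffunE /= inordK.
Qed.

Lemma pullback_face s g n t i : i <= n.+1 -> pullback s g n.+1 t ->
  pullback s (fun j => g (bump i j)) n (sface i t).
Proof.
move=> ni [f -> fg]; exists (dcomp f (coface (inord i))) => [|j].
  by rewrite sact_comp.
by rewrite ffunE fg ffunE /= inordK.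
Qed.

Lemma pullback_degens s g n t a : sorted ltn a -> all (fun i => i < n + size a) a ->
  pullback s g n t ->
  pullback s (fun j => g (j - count (fun i => i < j) a)) (n + size a) (sdegens a t).
Proof.
move=> + + nt; elim/last_ind: a => [|a i IH].
  by rewrite addn0 => _ _; apply: pullback_ext nt => j _; rewrite subn0.
rewrite !sorted_pairwise ?pairwise_rcons in IH *; do ?exact: ltn_trans.
case/andP=> ai' sa.
rewrite size_rcons all_rcons addnS ltnS => /andP[ni _].
rewrite /sdegens foldl_rcons -/(sdegens a t).
have {}IH : pullback s (fun j => g (j - count (fun i => i < j) a)) (n + size a) (sdegens a t).
  by apply: IH => //; apply: sub_all ai' => j /= ji; apply: leq_trans ji ni.
apply: pullback_ext (pullback_degen ni IH) => j jn /=; congr (g _).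
rewrite -cats1 count_cat /= addn0 /unbump.
have [ij|ji] := ltnP i j; last first.
  by rewrite !subn0 addn0.
have c1 : count (fun i => i < j - 1) a = size a.
  by apply/eqP; rewrite -all_count; apply: sub_all ai' => l /= li; lia.
have c2 : count (fun i => i < j) a = size a.
  by apply/eqP; rewrite -all_count; apply: sub_all ai' => l /= li; lia.
by rewrite c1 c2; lia.
Qed.

Lemma pullback_faces s g n t p q : p <= n.+1 ->
  pullback s g (n + (q.+1 - p)) t ->
  pullback s (fun j => g (if j < p then j else j + (q.+1 - p))) n (sfaces p q t).
Proof.
rewrite /sfaces /index_iota.
move: (q.+1 - p) => c; elim: c p n => [|c IH] p n pn /=.
  by rewrite addn0; apply: pullback_ext => j _; rewrite addn0 if_same.
rewrite addnS -addSn => /IH {}IH.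
apply: pullback_ext (pullback_face pn (IH p.+1 _)) => [j _|//].
by congr (g _); rewrite /bump; case: (ltnP j p) => jp; case: ifP => ?; lia.
Qed.

End TotalSimplices.

(* A shuffle is given by its first set a; its second set is ~: a. *)
Section ShuffleSets.
Variable n : nat.
Local Open Scope nat_scope.

(* The elements of a in increasing order *)
Definition elts (a : {set 'I_n}) : seq nat := [seq val i | i <- enum a].

Lemma perm_enum_setC (a : {set 'I_n}) : perm_eq (enum a ++ enum (~: a)) (enum 'I_n).
Proof.
apply: uniq_perm => [||i]; last 1 first.
- by rewrite mem_cat !mem_enum inE orbN.
- rewrite cat_uniq !enum_uniq andbT /=; apply/hasPn => i.
  by rewrite !mem_enum inE.
- exact: enum_uniq.
Qed.

Lemma size_enum_setC (a : {set 'I_n}) : size (enum a ++ enum (~: a)) = n.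
Proof. by rewrite (perm_size (perm_enum_setC a)) size_enum_ord. Qed.

Definition shuffle_fun (a : {set 'I_n}) (i : 'I_n) : 'I_n :=
  nth i (enum a ++ enum (~: a)) i.

Lemma shuffle_fun_inj a : injective (shuffle_fun a).
Proof.
move=> i j; rewrite /shuffle_fun (set_nth_default i j) ?size_enum_setC // => /eqP.
rewrite nth_uniq ?size_enum_setC // ?(perm_uniq (perm_enum_setC a)) ?enum_uniq //.
by move/eqP/val_inj.
Qed.

(* (a_1 < ... < a_p, b_1 < ... < b_q) for b the complement of a *)
Definition shuffle_perm (a : {set 'I_n}) : 'S_n := perm (@shuffle_fun_inj a).

Definition cnt (a : {set 'I_n}) (r : nat) : nat := count (fun i => i < r) (elts a).

Lemma cntC (a : {set 'I_n}) r : r <= n -> cnt a r + cnt (~: a) r = r.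
Proof.
move=> rn; rewrite /cnt -count_cat -map_cat.
rewrite (seq.permP (perm_map val (perm_enum_setC a))) val_enum_ord.
rewrite -(subnKC rn) iotaD count_cat.
have /eqP -> : count (fun i => i < r) (iota 0 r) == r.
  by rewrite -[X in _ == X](size_iota 0 r) -all_count; apply/allP => i; rewrite mem_iota.
rewrite -[RHS]addn0; congr (_ + _); apply/eqP; rewrite -leqn0 leqNgt -has_count.
by apply/hasPn => i; rewrite mem_iota add0n -leqNgt => /andP[].
Qed.

Lemma elts_lt (a : {set 'I_n}) : all (fun i => i < n) (elts a).
Proof. by apply/allP => i /mapP[j _ ->]; apply: ltn_ord. Qed.

Lemma elts_sorted (a : {set 'I_n}) : sorted ltn (elts a).
Proof.
have : sorted ltn (map val (enum 'I_n)) by rewrite val_enum_ord iota_ltn_sorted.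
apply: subseq_sorted; first exact: ltn_trans.
apply: map_subseq; rewrite enumT {1}/enum_mem.
exact: filter_subseq.
Qed.

Lemma size_elts (a : {set 'I_n}) : size (elts a) = #|a|.
Proof. by rewrite size_map -cardE. Qed.

Lemma cnt0 a : cnt a 0 = 0.
Proof. by rewrite /cnt; elim: (elts a). Qed.

Lemma cnt_full a : cnt a n = #|a|.
Proof. by rewrite -size_elts; apply/eqP; rewrite -all_count elts_lt. Qed.

Lemma cntS a r : cnt a r.+1 = cnt a r + (r \in elts a).
Proof.
have ua: uniq (elts a) by rewrite map_inj_uniq ?enum_uniq //; apply: val_inj.
rewrite -(count_uniq_mem r ua) /cnt; elim: (elts a) => //= i s ->.
by rewrite ltnS leq_eqVlt; case: eqP => [->|_]; rewrite ?ltnn /=; lia.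
Qed.

Lemma elts_setC a r : r \in elts a -> r \notin elts (~: a).
Proof.
case/mapP=> i; rewrite mem_enum => ia ->.
by rewrite mem_map ?mem_enum ?inE ?ia //; apply: val_inj.
Qed.

Lemma cnt_step (a : {set 'I_n}) t : t < #|a| ->
  exists r, [/\ r < n, cnt a r = t, cnt a r.+1 = t.+1 & cnt (~: a) r.+1 = cnt (~: a) r].
Proof.
rewrite -cnt_full; suff H N : N <= n -> t < cnt a N -> exists r,
    [/\ r < n, cnt a r = t, cnt a r.+1 = t.+1 & cnt (~: a) r.+1 = cnt (~: a) r].
  exact: H.
elim: N => [|N IH] Nn; first by rewrite cnt0.
have [/(IH (ltnW Nn)) //|tN] := ltnP t (cnt a N).
rewrite cntS => tN1; have Na : N \in elts a by case: (N \in elts a) tN1; lia.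
exists N; rewrite !cntS (negbTE (elts_setC Na)) Na addn0.
by rewrite Na in tN1; split=> //; lia.
Qed.
End ShuffleSets.

Section Chains.
Variables (k : comPzRingType) (X : sset).

Inductive degenerate_chain : set (freemod k {classic simp X}) :=
| DegenerateChain (s : simp X) of degenerate s :
    degenerate_chain (single k (s : {classic simp X})).

(* The graded module underlying the normalized chain complex, as a single
   module: its degree-n part is spanned by the classes of the n-simplices, and
   the tensor product of two such modules is the total tensor product. *)
Definition chain := quotmod degenerate_chain.
HB.instance Definition _ := GRing.Lmodule.on chain.

Definition cgen (s : simp X) : chain := qproj _ (single k (s : {classic simp X})).

Lemma cgen_degenerate s : degenerate s -> cgen s = 0.
Proof. by move=> sd; apply: proj0; constructor. Qed.

Section Lift.
Variables (V : lmodType k) (g : simp X -> V).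
Hypothesis g0 : forall s, degenerate s -> g s = 0.

Lemma clift0 u : degenerate_chain u -> free_lift (g : {classic simp X} -> V) u = 0.
Proof. by case=> s /g0 gs; rewrite free_lift_single. Qed.

Definition clift : chain -> V := quotmod_lift clift0.
HB.instance Definition _ := GRing.Linear.on clift.

Lemma cliftE s : clift (cgen s) = g s.
Proof. by rewrite /clift /cgen quotmod_lift_proj /= free_lift_single. Qed.
End Lift.

Lemma chain_ext (V : lmodType k) (f g : {linear chain -> V}) :
  (forall s, f (cgen s) = g (cgen s)) -> f =1 g.
Proof.
move=> fg t; have [r ->] := projP t; rewrite -(free_lift_id r).
have [s us rs] := free_supp r; rewrite (free_lift_seq _ us rs) !linear_sum /=.
by apply: eq_bigr => x _; rewrite !linearZ /=; congr (_ *: _); apply: fg.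
Qed.

(* x |-> (-1)^(d |x|) x *)
Definition csign_gen (d : nat) (s : simp X) : chain := (-1) ^+ (d * tag s) *: cgen s.

Lemma csign_gen0 d s : degenerate s -> csign_gen d s = 0.
Proof. by move=> sd; rewrite /csign_gen cgen_degenerate // scaler0. Qed.

Definition csign d : chain -> chain := clift (csign_gen0 d).
HB.instance Definition _ d := GRing.Linear.on (csign d).

Lemma csignE d s : csign d (cgen s) = (-1) ^+ (d * tag s) *: cgen s.
Proof. exact: cliftE. Qed.
End Chains.

Section ChainMap.
Variables (k : comPzRingType) (X Y : sset) (f : smap X Y).

Definition cmap_gen (s : simp X) : chain k Y := cgen k (existT _ (tag s) (f _ (tagged s))).

Lemma cmap_gen0 s : degenerate s -> cmap_gen s = 0.
Proof.
case=> n [i [x ->]]; apply: cgen_degenerate; exists n, i, (f _ x).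
by rewrite /= /degen smap_act.
Qed.

Definition cmap : chain k X -> chain k Y := clift cmap_gen0.
HB.instance Definition _ := GRing.Linear.on cmap.
End ChainMap.

(* Koszul sign rule: for g of degree d,
   (f ⊗ g)(x ⊗ c) = (-1)^(d |x|) f x ⊗ g c *)
Definition ktens (k : comPzRingType) (X X' Y Y' : sset) (d : nat)
    (f : {linear chain k X -> chain k X'}) (g : {linear chain k Y -> chain k Y'}) :
    tensor (chain k X) (chain k Y) -> tensor (chain k X') (chain k Y') :=
  tens_map (f \o csign d) g.

Lemma ktensE (k : comPzRingType) (X X' Y Y' : sset) d
    (f : {linear chain k X -> chain k X'}) (g : {linear chain k Y -> chain k Y'}) s c :
  ktens d f g (tens (cgen k s) c) =
  (-1) ^+ (d * tag s) *: tens (f (cgen k s)) (g c).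
Proof.
rewrite /ktens tens_mapE /= csignE linearZ /=.
have := tensDl ((-1) ^+ (d * tag s)) (f (cgen k s)) 0 (g c).
rewrite addr0 => ->; rewrite -[RHS]addr0; congr (_ + _).
have := tensDl 1 (0 : chain k X') 0 (g c); rewrite scale1r addr0 scale1r => h.
by apply: (addrI (tens 0 (g c))); rewrite addr0 -h.
Qed.

Section Pairs.
Variables (k : comPzRingType) (X Y : sset).

(* The class of (s, t) for simplices of the same dimension; see nabla_tag and
   EMH_tag for the fact that only this case occurs below. *)
Definition cpair (s : simp X) (t : simp Y) : chain k (sprod X Y) :=
  if tag t =P tag s is ReflectT e
  then @cgen k (sprod X Y) (existT (sprod X Y) (tag s) (tagged s, etagged e)) else 0.

Lemma cpairE n (x : X n) (y : Y n) :
  cpair (existT _ n x) (existT _ n y) = @cgen k (sprod X Y) (existT (sprod X Y) n (x, y)).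
Proof.
rewrite /cpair; case: eqP => //= e; congr (@cgen k (sprod X Y) (existT _ n (_, _))).
by rewrite (eq_irrelevance e (erefl _)).
Qed.

Lemma pullback_collapse (Z : sset) (z : simp Z) g n t (j : nat) : (j <= n)%N ->
  g j = g j.+1 -> pullback z g n.+1 t ->
  exists w : Z n, t = existT _ n.+1 (degen (inord j) w).
Proof.
move=> jn gj [f -> fg]; exists (sact (dcomp f (coface (inord j))) (tagged z)).
congr (existT _ _ _); rewrite /degen -sact_comp; congr (sact _ _).
apply: dhom_eq => i; rewrite !ffunE !fg /= ?ffunE /= !inordK ?ltnS ?(leqW jn) //.
have [->|ij] := eqVneq (nat_of_ord i) j.
  by rewrite /unbump /bump ltnn subn0 leqnn add1n.
by congr (g _); rewrite /unbump /bump; case: (ltnP j i) => ?; case: leqP; lia.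
Qed.

Lemma cpair_collapse x y g h n s t j : (j <= n)%N ->
  pullback x g n.+1 s -> pullback y h n.+1 t ->
  g j = g j.+1 -> h j = h j.+1 -> cpair s t = 0.
Proof.
move=> jn xs yt gj hj.
have [w ->] := pullback_collapse jn gj xs.
have [w' ->] := pullback_collapse jn hj yt.
by rewrite cpairE; apply: cgen_degenerate; exists n, (inord j), (w, w').
Qed.
End Pairs.

Lemma pullback_of_degen (X : sset) n (i : 'I_n.+1) (x : X n) g m t :
  pullback (existT X n.+1 (degen i x)) g m t ->
  pullback (existT X n x) (fun j => unbump i (g j)) m t.
Proof.
case=> f -> fg; exists (dcomp (codegen i) f) => [|j]; first by rewrite sact_comp.
by rewrite !ffunE /= -fg.
Qed.

Section Nabla.
Variables (k : comPzRingType) (X Y : sset).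

Definition nabla_gen (x : simp X) (y : simp Y) : chain k (sprod X Y) :=
  let p := tag x in let q := tag y in
  \sum_(a : {set 'I_(p + q)} | #|a| == p)
    (-1) ^+ shuffle_perm a *: cpair k (sdegens (elts (~: a)) x) (sdegens (elts a) y).

Section Terms.
Variables (x : simp X) (y : simp Y) (a : {set 'I_(tag x + tag y)}).
Hypothesis ax : #|a| = tag x.
Local Open Scope nat_scope.

Lemma nabla_card : #|~: a| = tag y.
Proof. by apply: (@addnI (tag x)); rewrite -{1}ax cardsC card_ord. Qed.

Lemma nabla_pullback1 : pullback x (cnt a) (tag x + tag y) (sdegens (elts (~: a)) x).
Proof.
have := pullback_degens (elts_sorted (~: a)) _ (pullback_id x).
rewrite size_elts nabla_card => /(_ (elts_lt _)); apply: pullback_ext => j jn /=.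
by rewrite -/(cnt (~: a) j) -{1}(cntC a jn) addnK.
Qed.

Lemma nabla_pullback2 : pullback y (cnt (~: a)) (tag x + tag y) (sdegens (elts a) y).
Proof.
have := pullback_degens (elts_sorted a) _ (pullback_id y).
rewrite size_elts ax addnC => /(_ (elts_lt _)); apply: pullback_ext => j jn /=.
by rewrite -/(cnt a j) -{1}(cntC a jn) addKn.
Qed.

Lemma nabla_tag : tag (sdegens (elts (~: a)) x) = tag x + tag y /\
  tag (sdegens (elts a) y) = tag x + tag y.
Proof. by rewrite (pullback_tag nabla_pullback1) (pullback_tag nabla_pullback2). Qed.
End Terms.

Lemma nabla_gen0l y x : degenerate x -> nabla_gen x y = 0.
Proof.
case=> n [i [z ->]]; rewrite /nabla_gen big1 // => a /eqP ax.
have [r [rn r0 r1 r2]] : exists r, [/\ (r < n.+1 + tag y)%N, cnt a r = i,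
    cnt a r.+1 = i.+1 & cnt (~: a) r.+1 = cnt (~: a) r].
  by apply: cnt_step; rewrite ax.
rewrite (cpair_collapse k (n := n + tag y) (j := r) _
  (pullback_of_degen (nabla_pullback1 ax)) (nabla_pullback2 ax)) ?scaler0 //.
by rewrite r0 r1 /unbump; lia.
Qed.

Lemma nabla_gen0r x y : degenerate y -> nabla_gen x y = 0.
Proof.
case=> n [i [z ->]]; rewrite /nabla_gen big1 // => a /eqP ax.
have [r [rn r0 r1 r2]] : exists r, [/\ (r < tag x + n.+1)%N, cnt (~: a) r = i,
    cnt (~: a) r.+1 = i.+1 & cnt (~: ~: a) r.+1 = cnt (~: ~: a) r].
  by apply: cnt_step; rewrite (nabla_card ax).
rewrite finset.setCK in r2.
rewrite [cpair _ _ _](_ : _ = 0) ?scaler0 //.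
have := pullback_of_degen (nabla_pullback2 ax); have := nabla_pullback1 ax.
move: (sdegens _ _) (sdegens _ _) (cnt a) (cnt (~: a)) r0 r1 r2 => s t g h r0 r1 r2.
rewrite /= addnS => sp tp.
rewrite (cpair_collapse k (j := r) _ sp tp) //; first by lia.
by rewrite r0 r1 /unbump; lia.
Qed.

Lemma nabla_linl0 x : degenerate x ->
  (fun c => clift (nabla_gen0r x) c) = 0 :> (chain k Y -> chain k (sprod X Y)).
Proof.
move=> xd; apply: funext => c; apply: (chain_ext (g := \0)) => y /=.
by rewrite cliftE nabla_gen0l.
Qed.

Definition nabla_bil : chain k X -> chain k Y -> chain k (sprod X Y) := clift nabla_linl0.

Lemma nabla_bilE x c : nabla_bil (cgen k x) c = clift (nabla_gen0r x) c.
Proof. by rewrite /nabla_bil cliftE. Qed.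

Lemma nabla_bil_linl c : linear (nabla_bil^~ c).
Proof. by move=> a u v; rewrite /nabla_bil linearP. Qed.

Lemma nabla_bil_linr u : linear (nabla_bil u).
Proof.
move=> a v w; pose h u := nabla_bil u (a *: v + w) - (a *: nabla_bil u v + nabla_bil u w).
have hl : linear h.
  move=> b s t; rewrite /h !nabla_bil_linl !scalerBr !scalerDr !scalerA (mulrC a).
  rewrite [in RHS]addrACA -opprD; congr (_ - _).
  by rewrite addrACA.
pose hL := GRing.isLinear.Build k (chain k X) _ _ h hl.
pose H : {linear chain k X -> chain k (sprod X Y)} := HB.pack h hL.
apply/eqP; rewrite -subr_eq0; apply/eqP.
apply: (chain_ext (f := H) (g := \0)) => x /=.
by rewrite /h !nabla_bilE linearP subrr.
Qed.

(* The shuffle map *)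
Definition nabla : tensor (chain k X) (chain k Y) -> chain k (sprod X Y) :=
  tens_lift nabla_bil_linl nabla_bil_linr.
HB.instance Definition _ := GRing.Linear.on nabla.

Lemma nablaE x y : nabla (tens (cgen k x) (cgen k y)) = nabla_gen x y.
Proof. by rewrite /nabla tens_liftE nabla_bilE cliftE. Qed.
End Nabla.

Section EMH.
Variables (k : comPzRingType) (X Y : sset).

Definition simp_fst (s : simp (sprod X Y)) : simp X := existT _ (tag s) (tagged s).1.
Definition simp_snd (s : simp (sprod X Y)) : simp Y := existT _ (tag s) (tagged s).2.

Definition EMH_fst n p q (a : {set 'I_(p.+1 + q)}) (x : simp X) : simp X :=
  let m := (n - p - q)%N in
  sdegens [seq i + m | i <- elts (~: a)]%N (sdegen (m - 1) (sfaces (n - q + 1) n x)).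

Definition EMH_snd n p q (a : {set 'I_(p.+1 + q)}) (y : simp Y) : simp Y :=
  let m := (n - p - q)%N in
  sdegens [seq i + m | i <- elts a]%N (sfaces m (n - q - 1) y).

Definition EMH_gen (s : simp (sprod X Y)) : chain k (sprod X Y) :=
  let n := tag s in
  \sum_(p < n) \sum_(q < n | (p + q < n)%N)
    let m := (n - p - q)%N in
    \sum_(a : {set 'I_(p.+1 + q)} | #|a| == p.+1)
      (-1) ^+ (m + 1 + shuffle_perm a) *:
        cpair k (EMH_fst n a (simp_fst s)) (EMH_snd n a (simp_snd s)).

Section Terms.
Local Open Scope nat_scope.

Lemma pullback_degens_shift (Z : sset) (s : simp Z) g d t N (a : {set 'I_N}) m :
  d + #|a| = N + m -> pullback s g d t ->
  pullback s (fun j => g (j - cnt a (j - m))) (N + m)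
    (sdegens [seq i + m | i <- elts a] t).
Proof.
move=> dN /(@pullback_degens _ _ _ _ _ [seq i + m | i <- elts a]).
rewrite size_map size_elts dN sorted_map all_map.
have -> : sorted (relpre (addn^~ m) ltn) (elts a).
  by apply: sub_sorted (elts_sorted a) => i j /=; rewrite ltn_add2r.
have -> : all (preim (addn^~ m) (fun i => i < N + m)) (elts a).
  by apply: sub_all (elts_lt a) => i /=; rewrite ltn_add2r.
move=> /(_ isT isT); apply: pullback_ext => j _; congr (g (_ - _)).
by rewrite count_map; apply: eq_count => i /=; rewrite ltn_subRL addnC.
Qed.

Variables (n p q : nat) (a : {set 'I_(p.+1 + q)}).
Hypotheses (pq : p + q < n) (ap : #|a| = p.+1).
Let m := n - p - q.

Lemma EMH_card : #|~: a| = q.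
Proof. by apply: (@addnI p.+1); rewrite -{1}ap cardsC card_ord. Qed.

Lemma cnt_le r : cnt a r <= p.+1.
Proof. by apply: leq_trans (count_size _ _) _; rewrite size_elts ap. Qed.

Lemma EMH_pullback1 (x : simp X) : tag x = n ->
  pullback x (fun j => if j < m then j else m - 1 + cnt a (j - m)) n.+1
    (EMH_fst n a x).
Proof.
move=> xn; have := pullback_id x; rewrite xn => h.
have {}h : pullback x id (n - q + (n.+1 - (n - q + 1))) x.
  by rewrite (_ : _ + _ = n) //; lia.
have {h} := pullback_faces _ h => /(_ _)/pullback_degen => h.
have /h {h} h1 : n - q + 1 <= (n - q).+1 by lia.
have /h1 {h1} : m - 1 <= n - q by rewrite /m; lia.
have := EMH_card => nac.
have dN : (n - q).+1 + #|~: a| = p.+1 + q + m by rewrite nac /m; lia.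
move=> /(pullback_degens_shift dN).
rewrite (_ : p.+1 + q + m = n.+1); last by rewrite /m; lia.
apply: pullback_ext => j jn; rewrite /unbump.
have := cntC a (_ : j - m <= p.+1 + q); have := cnt_le (j - m).
have [jm|mj] := ltnP j m.
  rewrite (_ : j - m = 0) ?cnt0; last by lia.
  by move=> _ _; rewrite /m in jm *; case: ifP; lia.
rewrite /m in mj * => h1 h2; have {}h2 := h2 ltac:(lia).
by case: ifP; lia.
Qed.

Lemma EMH_pullback2 (y : simp Y) : tag y = n ->
  pullback y (fun j => if j < m then j else m + p + cnt (~: a) (j - m)) n.+1
    (EMH_snd n a y).
Proof.
move=> yn; have := pullback_id y; rewrite yn => h.
have {}h : pullback y id (n - p + ((n - q - 1).+1 - m)) y.
  by rewrite (_ : _ + _ = n) // /m; lia.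
have {h} h1 := pullback_faces _ h.
have /h1 {h1} : m <= (n - p).+1 by rewrite /m; lia.
have dN : n - p + #|a| = p.+1 + q + m by rewrite ap /m; lia.
move=> /(pullback_degens_shift dN).
rewrite (_ : p.+1 + q + m = n.+1); last by rewrite /m; lia.
apply: pullback_ext => j jn.
have := cntC a (_ : j - m <= p.+1 + q).
have [jm|mj] := ltnP j m.
  rewrite (_ : j - m = 0) ?cnt0; last by lia.
  by move=> _; rewrite subn0 jm.
rewrite /m in mj * => h2; have {}h2 := h2 ltac:(lia).
by case: ifP; lia.
Qed.

Lemma EMH_tag (x : simp X) (y : simp Y) : tag x = n -> tag y = n ->
  tag (EMH_fst n a x) = n.+1 /\ tag (EMH_snd n a y) = n.+1.
Proof.
by move=> /EMH_pullback1/pullback_tag -> /EMH_pullback2/pullback_tag ->.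
Qed.
End Terms.

Lemma EMH_gen0 s : degenerate s -> EMH_gen s = 0.
Proof.
case=> n [i [[x y] ->]]; rewrite /EMH_gen big1 // => p _; rewrite big1 // => q pq.
rewrite big1 // => a /eqP ap; rewrite [cpair _ _ _](_ : _ = 0) ?scaler0 //.
have := pullback_of_degen (EMH_pullback1 pq ap (x := existT X n.+1 (degen i x)) erefl).
have := pullback_of_degen (EMH_pullback2 pq ap (y := existT Y n.+1 (degen i y)) erefl).
rewrite /= in p q pq a ap *.
set m := (n.+1 - p - q)%N => yp xp; have i_n := ltn_ord i.
have mE : (m + p + q = n.+1)%N by rewrite /m; lia.
have m0 : (0 < m)%N by rewrite /m; lia.
have [im|mi] := ltnP i.+1 m.
  apply: (cpair_collapse k (j := i) _ xp yp); rewrite ?im ?(ltnW im) /unbump; lia.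
have [imp|mpi] := ltnP i (m + p).
  have [r [rn r0 r1 r2]] : exists r, [/\ (r < p.+1 + q)%N, cnt a r = (i - (m - 1))%N,
      cnt a r.+1 = (i - (m - 1)).+1 & cnt (~: a) r.+1 = cnt (~: a) r].
    by apply: cnt_step; rewrite ap; lia.
  apply: (cpair_collapse k (j := m + r) _ xp yp); first by lia.
    rewrite !ltnNge !leq_addr -addnS leq_addr /= !addKn r0 r1 /unbump; lia.
  by rewrite !ltnNge !leq_addr -addnS leq_addr /= !addKn r2.
have [r [rn r0 r1 r2]] : exists r, [/\ (r < p.+1 + q)%N, cnt (~: a) r = (i - (m + p))%N,
    cnt (~: a) r.+1 = (i - (m + p)).+1 & cnt (~: ~: a) r.+1 = cnt (~: ~: a) r].
  by apply: cnt_step; rewrite (EMH_card ap); lia.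
rewrite finset.setCK in r2.
apply: (cpair_collapse k (j := m + r) _ xp yp); first by lia.
  by rewrite !ltnNge !leq_addr -addnS leq_addr /= !addKn r2.
rewrite !ltnNge !leq_addr -addnS leq_addr /= !addKn r0 r1 /unbump; lia.
Qed.

(* The Eilenberg-Mac Lane homotopy, a map of degree 1 *)
Definition EMH : chain k (sprod X Y) -> chain k (sprod X Y) := clift EMH_gen0.
HB.instance Definition _ := GRing.Linear.on EMH.

Lemma EMHE s : EMH (cgen k s) = EMH_gen s.
Proof. exact: cliftE. Qed.
End EMH.

Arguments cmap k {X Y} f.
Arguments nabla k X Y : clear implicits.
Arguments EMH k X Y : clear implicits.

(* Main.v *)
Require Import Defs.
From HB Require Import structures.
From mathcomp Require Import all_boot all_algebra all_fingroup.
From mathcomp Require Import zify.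
Set Implicit Arguments.
Unset Strict Implicit.
Unset Printing Implicit Defensive.
Import GRing.Theory.
Local Open Scope ring_scope.

(** Every simplex occurring in the two identities comes from a fixed triple
    (x, y, z) by pulling back along a lattice path, and a lattice path is a word
    whose letters are steps in N^3. On words the two maps become combinatorial:

    - the shuffle map sends a pair of words u, v to their signed shuffle product
      [nabla_path];
    - the homotopy H relative to a splitting of the coordinates into two groups
      phi and psi cuts a word as w1 w2 w3, keeps w1, lets the psi-coordinates jump
      at once over w2, and then shuffles the phi-part of w2 with the psi-part of
      w3, with sign (-1)^|w1| [EMH_path].

    A word containing the step 0 gives a degenerate simplex, that is, 0. The two
    identities then say that H commutes, up to the Koszul sign, with taking the
    shuffle product with a word u of pure phi-steps on the left
    [shuf_word_homotopyr], or with a word v of pure psi-steps on the right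
    [shuf_word_homotopyl]. This is a bialgebra argument. Cutting a word is
    compatible with shuffling [shuf_cuts], so H applied to a shuffle of u and v is
    a sum over simultaneous cuts u1 u2 u3 and v1 v2 v3. Steps of u3 have no
    psi-part, so such terms vanish unless u3 is empty; symmetrically v2 must be
    empty in the second identity. What survives has the shape
    (u1 shuffled with v1), jump, (a triple shuffle). The same sum results from
    shuffling u into a word of the form v1, jump, t: distribute u before and
    after the jump [shuf_letterr, shuf_letterl] and use that the shuffle product
    is associative [shufA].

    Sums over words are written in continuation style: shuf u v F is the signed
    sum of F over the shuffles of u and v, with values in a module. *)

(** * Signed shuffle products and cuts of words *)

Lemma sign_odd (R : pzRingType) m n : odd m = odd n -> (-1) ^+ m = (-1) ^+ n :> R.
Proof. by rewrite -signr_odd => ->; rewrite signr_odd. Qed.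

Section Shuffles.
Variables (k : comPzRingType) (L : eqType).
Implicit Types (V : lmodType k) (u v w : seq L).

(** All letters have degree 1, so moving the first letter of the second word in
    front of the whole first word costs the sign (-1)^(size u). *)
Fixpoint shuf V u {struct u} : seq L -> (seq L -> V) -> V :=
  if u is a :: u' then
    fix shuf_u v F :=
      if v is b :: v' then
        shuf u' v (fun w => F (a :: w)) + (-1) ^+ size u *: shuf_u v' (fun w => F (b :: w))
      else F u
  else fun v F => F v.

Lemma shufs0 V u (F : seq L -> V) : shuf u [::] F = F u.
Proof. by case: u. Qed.

Lemma shuf_cons V a u b v (F : seq L -> V) :
  shuf (a :: u) (b :: v) F =
    shuf u (b :: v) (fun w => F (a :: w))
    + (-1) ^+ (size u).+1 *: shuf (a :: u) v (fun w => F (b :: w)).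
Proof. by []. Qed.

Arguments shuf : simpl never.

Lemma shuf_ind (P : seq L -> seq L -> Prop) :
  (forall v, P [::] v) -> (forall u, P u [::]) ->
  (forall a u b v, P u (b :: v) -> P (a :: u) v -> P (a :: u) (b :: v)) ->
  forall u v, P u v.
Proof.
move=> P0 P1 P2; elim=> [//|a u IHu]; elim=> [//|b v IHv].
exact: P2.
Qed.

Lemma eq_shuf V u v (F F' : seq L -> V) :
  (forall w, perm_eq w (u ++ v) -> F w = F' w) -> shuf u v F = shuf u v F'.
Proof.
move: u v F F'; apply: shuf_ind => [v|u|a u b v IHu IHv] F F' FF'.
- exact: FF'.
- by rewrite !shufs0; apply: FF'; rewrite cats0.
- rewrite !shuf_cons; congr (_ + _ *: _); [apply: IHu|apply: IHv] => w pw; apply: FF'.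
    by rewrite /= perm_cons.
  by rewrite perm_sym perm_catC /= perm_cons perm_catC perm_sym.
Qed.

Lemma shufD V u v (F F' : seq L -> V) :
  shuf u v (fun w => F w + F' w) = shuf u v F + shuf u v F'.
Proof.
move: u v F F'; apply: shuf_ind => [v|u|a u b v IHu IHv] F F'; rewrite ?shufs0 ?shuf_cons //.
by rewrite IHu IHv scalerDr addrACA.
Qed.

Lemma shufZ V u v c (F : seq L -> V) :
  shuf u v (fun w => c *: F w) = c *: shuf u v F.
Proof.
move: u v F; apply: shuf_ind => [v|u|a u b v IHu IHv] F; rewrite ?shufs0 ?shuf_cons //.
by rewrite IHu IHv scalerDr !scalerA mulrC.
Qed.

Lemma shuf0 V u v (F : seq L -> V) :
  (forall w, perm_eq w (u ++ v) -> F w = 0) -> shuf u v F = 0.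
Proof.
move=> F0; rewrite (eq_shuf (F' := fun w => 0 *: F w)) ?shufZ ?scale0r //.
by move=> w /F0 ->; rewrite scaler0.
Qed.

Lemma shuf_sum V I (r : seq I) u v (F : I -> seq L -> V) :
  shuf u v (fun w => \sum_(i <- r) F i w) = \sum_(i <- r) shuf u v (F i).
Proof.
elim: r => [|i r IH]; first by rewrite big_nil shuf0 // => w _; rewrite big_nil.
rewrite big_cons -IH -shufD; apply: eq_shuf => w _.
by rewrite big_cons.
Qed.

Lemma linear_shuf V V' (h : {linear V -> V'}) u v (F : seq L -> V) :
  h (shuf u v F) = shuf u v (fun w => h (F w)).
Proof.
move: u v F; apply: shuf_ind => [v|u|a u b v IHu IHv] F; rewrite ?shufs0 ?shuf_cons //.
by rewrite linearD linearZ /= IHu IHv.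
Qed.

Lemma shuf_swap V u v u' v' (F : seq L -> seq L -> V) :
  shuf u v (fun w => shuf u' v' (F w)) = shuf u' v' (fun w' => shuf u v (F^~ w')).
Proof.
move: u v F; apply: shuf_ind => [v|u|a u b v IHu IHv] F //.
  by rewrite shufs0; apply: eq_shuf => w _; rewrite shufs0.
by rewrite shuf_cons IHu IHv -shufZ -shufD.
Qed.

Lemma shuf_map V (h : L -> L) u v (F : seq L -> V) :
  shuf (map h u) (map h v) F = shuf u v (fun w => F (map h w)).
Proof.
move: u v F; apply: shuf_ind => [v|u|a u b v IHu IHv] F //=.
  by rewrite !shufs0.
by rewrite !shuf_cons (IHu (fun w => F (h a :: w))) size_map (IHv (fun w => F (h b :: w))).
Qed.

Lemma shufC V u v (F : seq L -> V) :
  shuf u v F = (-1) ^+ (size u * size v) *: shuf v u F.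
Proof.
move: u v F; apply: shuf_ind => [v|u|a u b v IHu IHv] F.
- by rewrite shufs0 scale1r.
- by rewrite shufs0 muln0 scale1r.
- rewrite !shuf_cons IHu IHv scalerDr !scalerA addrC -!exprD.
  by congr (_ *: _ + _ *: _); apply: sign_odd; rewrite /= !(oddM, oddD) /=;
    case: (odd (size u)); case: (odd (size v)).
Qed.

Lemma shuf_consl V u v a c w (F : seq L -> V) :
  shuf u v (fun t => shuf (a :: t) (c :: w) F) =
    shuf u v (fun t => shuf t (c :: w) (fun s => F (a :: s)))
    + (-1) ^+ (size u + size v).+1 *: shuf u v (fun t => shuf (a :: t) w (fun s => F (c :: s))).
Proof.
rewrite -shufZ -shufD; apply: eq_shuf => t /perm_size st.
by rewrite shuf_cons st size_cat.
Qed.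

Lemma shuf_consr V v w a u b (F : seq L -> V) :
  shuf v w (fun t => shuf (a :: u) (b :: t) F) =
    shuf v w (fun t => shuf u (b :: t) (fun s => F (a :: s)))
    + (-1) ^+ (size u).+1 *: shuf v w (fun t => shuf (a :: u) t (fun s => F (b :: s))).
Proof. by rewrite -shufZ -shufD. Qed.

(** Both sides are the signed sum over shuffles of three words; each is
    expanded according to which of the three provides the first letter. *)
Lemma shufA V u v w (F : seq L -> V) :
  shuf u v (fun t => shuf t w F) = shuf v w (fun t => shuf u t F).
Proof.
elim: u v w F => [|a u IHu] v w F; first by [].
elim: v w F => [|b v IHv] w F; first by rewrite shufs0.
elim: w F => [|c w IHw] F.
  by rewrite shufs0; apply: eq_shuf => t _; rewrite shufs0.
have := IHw (fun s => F (c :: s)); rewrite [LHS]shuf_cons => {}IHw.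
rewrite [LHS]shuf_cons [RHS]shuf_cons.
rewrite (shuf_consl _ _ a) (shuf_consl _ _ b) (shuf_consr _ _ a _ b) (shuf_consr _ _ a _ c).
rewrite -IHw IHu (IHv (c :: w) (fun s => F (b :: s))).
rewrite (shuf_cons b v c w (fun t => shuf u t _)).
rewrite !scalerDr !scalerA -!exprD.
rewrite -!addrA; congr (_ + _).
rewrite addrCA [RHS]addrCA [LHS]addrCA; congr (_ + _); rewrite [LHS]addrCA.
congr (_ + (_ *: _ + _ *: _)); apply: sign_odd; rewrite /= !(oddD, addSn, addnS) /= ?oddD;
  by case: (odd (size u)); case: (odd (size v)).
Qed.

Definition cuts V w (F : seq L -> seq L -> V) : V :=
  \sum_(i < (size w).+1) F (take i w) (drop i w).

Lemma cuts0 V (F : seq L -> seq L -> V) : cuts [::] F = F [::] [::].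
Proof. by rewrite /cuts big_ord1. Qed.

Lemma cuts_cons V a w (F : seq L -> seq L -> V) :
  cuts (a :: w) F = F [::] (a :: w) + cuts w (fun w1 w2 => F (a :: w1) w2).
Proof. by rewrite /cuts big_ord_recl. Qed.

Lemma eq_cuts V w (F F' : seq L -> seq L -> V) :
  (forall w1 w2, w = w1 ++ w2 -> F w1 w2 = F' w1 w2) -> cuts w F = cuts w F'.
Proof. by move=> FF'; apply: eq_bigr => i _; apply: FF'; rewrite cat_take_drop. Qed.

Lemma cutsD V w (F F' : seq L -> seq L -> V) :
  cuts w (fun w1 w2 => F w1 w2 + F' w1 w2) = cuts w F + cuts w F'.
Proof. exact: big_split. Qed.

Lemma cutsZ V w c (F : seq L -> seq L -> V) :
  cuts w (fun w1 w2 => c *: F w1 w2) = c *: cuts w F.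
Proof. by rewrite /cuts scaler_sumr. Qed.

Lemma shuf_cuts_swap V u v w (F : seq L -> seq L -> seq L -> V) :
  shuf u v (fun t => cuts w (fun w1 w2 => F w1 w2 t)) =
  cuts w (fun w1 w2 => shuf u v (F w1 w2)).
Proof. exact: shuf_sum. Qed.

Lemma cuts_swap V u v (F : seq L -> seq L -> seq L -> seq L -> V) :
  cuts u (fun u1 u2 => cuts v (F u1 u2)) =
  cuts v (fun v1 v2 => cuts u (fun u1 u2 => F u1 u2 v1 v2)).
Proof. exact: exchange_big. Qed.

Lemma cuts_last V w (F : seq L -> seq L -> V) :
  (forall w1 a w2, w = w1 ++ a :: w2 -> F w1 (a :: w2) = 0) -> cuts w F = F w [::].
Proof.
elim: w F => [|a w IH] F F0; first by rewrite cuts0.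
rewrite cuts_cons (F0 [::] a w) // add0r IH // => w1 b w2 wE.
by apply: F0; rewrite wE.
Qed.

(** Deconcatenation is multiplicative for the shuffle product: a prefix of a
    shuffle of u and v is a shuffle of a prefix of u with a prefix of v. The sign
    is that of moving v1 past u2. *)
Lemma shuf_cuts V u v (F : seq L -> seq L -> V) :
  shuf u v (fun w => cuts w F) =
  cuts u (fun u1 u2 => cuts v (fun v1 v2 => (-1) ^+ (size v1 * size u2) *:
    shuf u1 v1 (fun w1 => shuf u2 v2 (F w1)))).
Proof.
move: u v F; apply: shuf_ind => [v|u|a u b v IHu IHv] F.
- by rewrite cuts0; apply: eq_cuts => v1 v2 _; rewrite muln0 scale1r.
- rewrite shufs0; apply: eq_cuts => u1 u2 _.
  by rewrite cuts0 mul0n scale1r !shufs0.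
have cutE c t : cuts (c :: t) F = F [::] (c :: t) + cuts t (fun w1 => F (c :: w1)).
  exact: cuts_cons.
rewrite shuf_cons.
rewrite (eq_shuf (F' := fun t => F [::] (a :: t) + cuts t (fun w1 => F (a :: w1)))) //.
rewrite [X in _ + _ *: X](eq_shuf
  (F' := fun t => F [::] (b :: t) + cuts t (fun w1 => F (b :: w1)))) //.
rewrite !shufD scalerDr addrACA -shuf_cons IHu IHv.
rewrite [in RHS]cuts_cons [in RHS]cuts_cons mul0n scale1r -[RHS]addrA; congr (_ + _).
rewrite [X in _ + _ *: X]cuts_cons scalerDr addrCA -cutsZ; congr (_ + _).
  by apply: eq_cuts => v1 v2 _; rewrite scalerA -exprD.
rewrite -cutsZ -cutsD; apply: eq_cuts => u1 u2 uE.
rewrite [in LHS]cuts_cons [in RHS]cuts_cons -addrA; congr (_ + _).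
  by rewrite !mul0n !scale1r !shufs0.
rewrite -cutsZ -cutsD; apply: eq_cuts => v1 v2 _.
rewrite shuf_cons scalerDr !scalerA -!exprD; congr (_ + _ *: _).
apply: sign_odd; rewrite uE size_cat /= !(oddD, oddM, oddS) /=.
by case: (odd (size u1)); case: (odd (size u2)); case: (odd (size v1)).
Qed.

(** A marked letter c of the first word ends up somewhere in the shuffle, and
    the letters of v are distributed to its left and to its right; the left ones
    have moved past c :: t. *)
Lemma shuf_letterl V u c t v (F : seq L -> V) :
  shuf (u ++ c :: t) v F =
  cuts v (fun v1 v2 => (-1) ^+ (size v1 * (size t).+1) *:
    shuf u v1 (fun w1 => shuf t v2 (fun w2 => F (w1 ++ c :: w2)))).
Proof.
elim: u v F => [|a u IHu] v F.
  elim: v F => [|b v IHv] F; first by rewrite cuts0 mul0n scale1r !shufs0.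
  rewrite [LHS]shuf_cons [in LHS]IHv cuts_cons mul0n scale1r; congr (_ + _).
  rewrite -cutsZ; apply: eq_cuts => v1 v2 _.
  by rewrite scalerA -exprD -mulSn.
elim: v F => [|b v IHv] F; first by rewrite cuts0 mul0n scale1r !shufs0.
rewrite [LHS]shuf_cons -/cat IHu cuts_cons [in RHS]cuts_cons.
rewrite [X in _ + _ *: X]IHv -addrA !mul0n !scale1r !shufs0; congr (_ + _).
rewrite -cutsZ -cutsD; apply: eq_cuts => v1 v2 _.
rewrite shuf_cons scalerDr !scalerA -!exprD; congr (_ + _ *: _).
apply: sign_odd; rewrite size_cat /= !(oddD, oddM, oddS) /=.
by case: (odd (size u)); case: (odd (size t)); case: (odd (size v1)).
Qed.

Lemma shuf_letterr V u c t v (F : seq L -> V) :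
  shuf v (u ++ c :: t) F =
  cuts v (fun v1 v2 => (-1) ^+ ((size u).+1 * size v2) *:
    shuf v1 u (fun w1 => shuf v2 t (fun w2 => F (w1 ++ c :: w2)))).
Proof.
rewrite shufC shuf_letterl -cutsZ; apply: eq_cuts => v1 v2 vE.
rewrite scalerA shufC scalerA [in RHS](eq_shuf (F' := fun w1 => (-1) ^+ (size t * size v2) *:
  shuf t v2 (fun w2 => F (w1 ++ c :: w2)))); last first.
  by move=> w1 _; rewrite shufC mulnC.
rewrite shufZ scalerA -!exprD; congr (_ *: _).
apply: sign_odd; rewrite vE !size_cat /= !(oddD, oddM, oddS) /=.
by case: (odd (size u)); case: (odd (size t)); case: (odd (size v1)); case: (odd (size v2)).
Qed.

End Shuffles.

(** * The homotopy on words *)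

Section WordHomotopy.
Variables (k : comPzRingType) (L : nmodType) (V : lmodType k).
Variables (phi psi : L -> L) (G : seq L -> V).
Implicit Types (u v w : seq L).

(** A single letter, by which the psi-coordinates cross the whole word at once. *)
Definition jump w : L := \sum_(l <- w) psi l.

(** An empty middle part w2 is allowed: its jump is 0, which gives a degenerate
    simplex in the intended use, so these terms do not contribute. *)
Definition word_homotopy w : V :=
  cuts w (fun w12 w3 => cuts w12 (fun w1 w2 => (-1) ^+ size w1 *:
    shuf (map phi w2) (map psi w3) (fun t => G (w1 ++ jump w2 :: t)))).

Lemma jump_perm w w' : perm_eq w w' -> jump w = jump w'.
Proof. exact: perm_big. Qed.

Lemma jump_cat w w' : jump (w ++ w') = jump w + jump w'.
Proof. exact: big_cat. Qed.

Lemma jump0 w : {in w, forall l, psi l = 0} -> jump w = 0.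
Proof. by move=> w0; rewrite /jump big_seq big1 // => l lw; apply: w0. Qed.

Lemma shuf_map_fst u v (F : seq L -> V) :
  {in u, forall l, phi l = l} -> shuf u (map phi v) F = shuf u v (fun w => F (map phi w)).
Proof.
move=> ul; rewrite -shuf_map; congr (shuf _ _ _); apply/esym.
by rewrite -[RHS]map_id; apply/eq_in_map.
Qed.

End WordHomotopy.

Section WordHomotopyShuffle.
Variables (k : comPzRingType) (L : nmodType) (V : lmodType k).
Variables (phi psi : L -> L) (G : seq L -> V).
Hypothesis G0 : forall w, 0 \in w -> G w = 0.
Implicit Types (u v w : seq L).
Local Notation jump := (jump psi).

(** A letter of u in the last of the three pieces has psi-part 0 and kills the
    term, so u is only cut in two. The exponent comparison uses that u1 is part of
    the prefix counted by the sign of the homotopy, whereas u2 is moved past the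
    jump; together they account for (-1)^(size u). *)
Lemma shuf_word_homotopyr u v :
  {in u, forall l, phi l = l} -> {in u, forall l, psi l = 0} ->
  shuf u v (word_homotopy phi psi G) =
  (-1) ^+ size u *: word_homotopy phi psi (shuf u ^~ G) v.
Proof.
move=> uphi upsi.
(* The last piece contains no letter of u. *)
rewrite /word_homotopy shuf_cuts cuts_last; last first.
  move=> u1 c u3 uE; rewrite /cuts big1 // => i _.
  rewrite shuf0 ?scaler0 // => w12 _; rewrite shuf0 // => w3 w3E.
  rewrite big1 // => j _; rewrite shuf0 ?scaler0 // => t tE; apply: G0.
  rewrite mem_cat inE (perm_mem tE) mem_cat; apply/orP; right; apply/orP; right.
  apply/orP; right; apply/mapP; exists c; last by rewrite upsi // uE mem_cat mem_head orbT.
  by rewrite (perm_mem w3E) mem_cat mem_head.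
rewrite -cutsZ; apply: eq_cuts => v12 v3 vE.
rewrite muln0 scale1r.
rewrite (eq_shuf (F' := fun w12 => cuts w12 (fun w1 w2 => (-1) ^+ size w1 *:
  shuf (map phi w2) (map psi v3) (fun t => G (w1 ++ jump w2 :: t))))) //.
rewrite shuf_cuts cuts_swap -cutsZ; apply: eq_cuts => v1 v2 _.
(* On the right-hand side, u is distributed around the jump. *)
rewrite (eq_shuf (F' := fun t => cuts u (fun u1 u2 => (-1) ^+ ((size v1).+1 * size u2) *:
    shuf u1 v1 (fun w1 => shuf u2 t (fun s => G (w1 ++ jump v2 :: s)))))); last first.
  by move=> t _; rewrite shuf_letterr.
rewrite shuf_cuts_swap -!cutsZ; apply: eq_cuts => u1 u2 uE.
rewrite shufZ !scalerA -exprD [in RHS]shuf_swap.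
have u2phi : {in u2, forall l, phi l = l} by move=> l lu; rewrite uphi // uE mem_cat lu orbT.
have u2psi : {in u2, forall l, psi l = 0} by move=> l lu; rewrite upsi // uE mem_cat lu orbT.
rewrite [in RHS](eq_shuf (F' := fun w1 => shuf u2 v2 (fun w2 =>
  shuf (map phi w2) (map psi v3) (fun s => G (w1 ++ jump v2 :: s))))); last first.
  move=> w1 _; rewrite -(shufA u2 _ _ (fun s => G (w1 ++ jump v2 :: s))).
  exact: (shuf_map_fst _ (fun w2 => shuf w2 _ _) u2phi).
rewrite (eq_shuf (F' := fun w1 => (-1) ^+ (size u1 + size v1) *: shuf u2 v2 (fun w2 =>
  shuf (map phi w2) (map psi v3) (fun s => G (w1 ++ jump v2 :: s))))); last first.
  move=> w1 /perm_size w1E; rewrite -shufZ; apply: eq_shuf => w2 w2E.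
  by rewrite w1E size_cat (jump_perm psi w2E) jump_cat jump0 // add0r.
rewrite shufZ scalerA -!exprD; congr (_ *: _).
apply: sign_odd; rewrite uE size_cat /= !(oddD, oddM, oddS) /=.
by case: (odd (size u1)); case: (odd (size u2)); case: (odd (size v1)).
Qed.

(** Here a letter of v in the middle piece has phi-part 0 and kills the term, so
    v is cut in two, into parts before and after the jump. The letters of v before
    the jump contribute to the sign of the homotopy exactly what they contribute
    on the right for having moved past the jump itself. *)
Lemma shuf_word_homotopyl u v :
  {in v, forall l, phi l = 0} -> {in v, forall l, psi l = l} ->
  shuf u v (word_homotopy phi psi G) =
  word_homotopy phi psi (fun w => shuf w v G) u.
Proof.
move=> vphi vpsi; rewrite /word_homotopy shuf_cuts; apply: eq_cuts => u12 u3 _.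
rewrite (eq_cuts (F' := fun v12 v3 => cuts u12 (fun u1 u2 =>
  (-1) ^+ (size v12 * (size (u2 ++ u3)) + size u1 + size v12) *:
  shuf u1 v12 (fun w1 => shuf u3 v3 (fun w3 => shuf (map phi u2) (map psi w3)
    (fun t => G (w1 ++ jump u2 :: t))))))); last first.
  move=> v12 v3 vE; rewrite (eq_shuf (F' := fun w12 => cuts w12 (fun w1 w2 =>
    shuf u3 v3 (fun w3 => (-1) ^+ size w1 *:
      shuf (map phi w2) (map psi w3) (fun t => G (w1 ++ jump w2 :: t)))))); last first.
    by move=> w12 _; rewrite -shuf_cuts_swap.
  rewrite shuf_cuts -cutsZ; apply: eq_cuts => u1 u2 _.
  (* The middle piece contains no letter of v. *)
  rewrite cuts_last; last first.
    move=> v1 c v2 v12E; rewrite shuf0 ?scaler0 // => w1 _; rewrite shuf0 // => w2 w2E.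
    rewrite shuf0 // => w3 _; rewrite shuf0 ?scaler0 // => t tE; apply: G0.
    rewrite mem_cat inE (perm_mem tE) mem_cat; apply/orP; right; apply/orP; right.
    apply/orP; left; apply/mapP; exists c.
      by rewrite (perm_mem w2E) !mem_cat mem_head orbT.
    by rewrite vphi // vE v12E -catA mem_cat mem_head orbT.
  rewrite (eq_shuf (F' := fun w1 => (-1) ^+ (size u1 + size v12) *: shuf u3 v3 (fun w3 =>
    shuf (map phi u2) (map psi w3) (fun t => G (w1 ++ jump u2 :: t))))); last first.
    by move=> w1 /perm_size w1E; rewrite shufs0 -shufZ w1E size_cat.
  rewrite shufZ !scalerA -!exprD; congr (_ ^+ _ *: _).
  by rewrite size_cat mulnDr (addnC (_ * size u2)%N) addnA.
rewrite cuts_swap; apply: eq_cuts => u1 u2 _.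
rewrite (eq_shuf (F' := fun t => cuts v (fun v1 v2 => (-1) ^+ (size v1 * (size t).+1) *:
    shuf u1 v1 (fun w1 => shuf t v2 (fun s => G (w1 ++ jump u2 :: s)))))); last first.
  by move=> t _; rewrite shuf_letterl.
rewrite shuf_cuts_swap -!cutsZ; apply: eq_cuts => v1 v2 vE.
have psi2 : map psi v2 = v2.
  by rewrite -[RHS]map_id; apply/eq_in_map => l lv; rewrite vpsi // vE mem_cat lv orbT.
rewrite [in RHS](eq_shuf (F' := fun t => (-1) ^+ (size v1 * (size (u2 ++ u3)).+1) *:
    shuf u1 v1 (fun w1 => shuf t v2 (fun s => G (w1 ++ jump u2 :: s))))); last first.
  by move=> t /perm_size tE; rewrite tE !size_cat !size_map.
rewrite shufZ scalerA -exprD [in RHS]shuf_swap.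
congr (_ *: _).
  by congr (_ ^+ _); rewrite mulnS -addnA [LHS]addnC -addnA.
by apply: eq_shuf => w1 _; rewrite [RHS]shufA -[in RHS]psi2 shuf_map.
Qed.

End WordHomotopyShuffle.

(** * Shuffle sets *)

Fixpoint riffle (T : Type) (b : bitseq) (u v : seq T) : seq T :=
  if b is c :: b' then
    if c then (if u is x :: u' then x :: riffle b' u' v else riffle b' u v)
    else (if v is y :: v' then y :: riffle b' u v' else riffle b' u v)
  else [::].

Definition pattern n (a : {set 'I_n}) : bitseq := [seq i \in a | i <- enum 'I_n].

Lemma enum_set_filter (T : finType) (a : {set T}) : enum a = [seq i <- enum T | i \in a].
Proof. by rewrite enumT. Qed.

(** Subsets of {0, ..., n} are the sets shift_set a and ord0 |: shift_set a; this
    is the recursion on shuffles according to their first letter. *)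
Section ShiftedSets.
Variable n : nat.
Implicit Types a : {set 'I_n}.

Definition shift_set a : {set 'I_n.+1} := lift ord0 @: a.

Lemma mem_shift_set a i : (lift ord0 i \in shift_set a) = (i \in a).
Proof. by rewrite mem_imset //; apply: lift_inj. Qed.

Lemma ord0_shift_set a : (ord0 \in shift_set a) = false.
Proof. by apply/negP => /imsetP[i _]; move/eqP; rewrite (negbTE (neq_lift _ _)). Qed.

Lemma lift0_neq (i : 'I_n) : lift ord0 i != ord0 :> 'I_n.+1.
Proof. by rewrite eq_sym neq_lift. Qed.

Lemma enum_shift_set a : enum (shift_set a) = map (lift ord0) (enum a).
Proof.
rewrite !enum_set_filter enum_ordSl /= ord0_shift_set filter_map.
by rewrite (eq_filter (a2 := [in a])) // => i /=; rewrite mem_shift_set.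
Qed.

Lemma enum_shift_set1 a : enum (ord0 |: shift_set a) = ord0 :: map (lift ord0) (enum a).
Proof.
rewrite !enum_set_filter enum_ordSl /= setU11 filter_map.
rewrite (eq_filter (a2 := [in a])) // => i /=.
by rewrite inE mem_shift_set in_set1 -[_ == _]negbK lift0_neq.
Qed.

Lemma shift_setC a : ~: shift_set a = ord0 |: shift_set (~: a).
Proof.
apply/setP => i; case: (unliftP ord0 i) => [j ->|->]; rewrite !inE.
  by rewrite !mem_shift_set inE (negbTE (lift0_neq _)).
by rewrite ord0_shift_set eqxx.
Qed.

Lemma shift_setC1 a : ~: (ord0 |: shift_set a) = shift_set (~: a).
Proof. by rewrite -[a in LHS]finset.setCK -shift_setC finset.setCK. Qed.

Lemma shuffle_perm_shift1 a :
  shuffle_perm (ord0 |: shift_set a) = lift_perm ord0 ord0 (shuffle_perm a).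
Proof.
apply/permP => i; rewrite permE /shuffle_fun enum_shift_set1 shift_setC1 enum_shift_set.
rewrite cat_cons -map_cat; case: (unliftP ord0 i) => [j ->|->]; last by rewrite lift_perm_id.
by rewrite lift_perm_lift permE /= add0n (nth_map j) ?size_enum_setC.
Qed.

(** In the list of shift_set a followed by its complement, 0 comes right after the
    elements of the set, whence the position #|a| and the sign (-1)^#|a|. *)
Lemma shuffle_perm_shift a :
  shuffle_perm (shift_set a) = lift_perm (inord #|a|) ord0 (shuffle_perm a).
Proof.
have an : (#|a| < n.+1)%N by rewrite ltnS -[X in (_ <= X)%N]card_ord max_card.
apply/permP => i; rewrite permE /shuffle_fun enum_shift_set shift_setC enum_shift_set1.
rewrite nth_cat size_map -cardE.
case: (unliftP (inord #|a|) i) => [j ->|->]; last first.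
  by rewrite lift_perm_id inordK // ltnn subnn.
rewrite lift_perm_lift permE /= inordK // /shuffle_fun nth_cat -cardE /bump.
have [ja|ja] := leqP #|a| j.
  rewrite add1n [(_ < #|a|)%N]ltnNge leqW //= subSn //=.
  by rewrite (nth_map j) // -(ltn_add2l #|a|) subnKC // cardE -size_cat size_enum_setC.
by rewrite add0n ja (nth_map j) // -cardE.
Qed.

Lemma card_shift_set a : #|shift_set a| = #|a|.
Proof. by rewrite card_imset //; apply: lift_inj. Qed.

Lemma card_shift_set1 a : #|ord0 |: shift_set a| = #|a|.+1.
Proof. by rewrite cardsU1 ord0_shift_set card_shift_set. Qed.

Lemma pattern_shift a : pattern (shift_set a) = false :: pattern a.
Proof.
rewrite /pattern enum_ordSl /= ord0_shift_set -map_comp; congr (_ :: _).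
by apply: eq_map => i /=; rewrite mem_shift_set.
Qed.

Lemma pattern_shift1 a : pattern (ord0 |: shift_set a) = true :: pattern a.
Proof.
rewrite /pattern enum_ordSl /= setU11 -map_comp; congr (_ :: _).
by apply: eq_map => i /=; rewrite inE mem_shift_set in_set1 -[_ == _]negbK lift0_neq.
Qed.

Lemma sum_shift_set (V : nmodType) (P : pred {set 'I_n.+1}) (f : {set 'I_n.+1} -> V) :
  \sum_(a | P a) f a =
  \sum_(a | P (ord0 |: shift_set a)) f (ord0 |: shift_set a)
  + \sum_(a | P (shift_set a)) f (shift_set a).
Proof.
rewrite (bigID (fun b : {set _} => ord0 \in b)) /=; congr (_ + _).
  rewrite (reindex_onto (fun a => ord0 |: shift_set a) (fun b => lift ord0 @^-1: b)).
    apply: eq_bigl => a; rewrite setU11 andbT; apply/andb_idr => _; apply/eqP/setP => i.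
    by rewrite !inE mem_shift_set (negbTE (lift0_neq _)).
  move=> a /andP[_ a0]; apply/setP => i; rewrite !inE.
  by case: (unliftP ord0 i) => [j ->|->]; rewrite ?mem_shift_set ?inE
    ?(negbTE (lift0_neq _)) ?eqxx.
rewrite (reindex_onto shift_set (fun b => lift ord0 @^-1: b)).
  apply: eq_bigl => a; rewrite ord0_shift_set andbT; apply/andb_idr => _.
  by apply/eqP/setP => i; rewrite !inE mem_shift_set.
move=> a /andP[_ a0]; apply/setP => i.
case: (unliftP ord0 i) => [j ->|->]; first by rewrite mem_shift_set inE.
by rewrite ord0_shift_set (negbTE a0).
Qed.
End ShiftedSets.

(** The sign of a shuffle permutation and the sign in the recursive shuffle
    product agree, as both count inversions one first letter at a time. *)
Lemma sum_shuffles (k : comPzRingType) (V : lmodType k) (L : eqType) n (u v : seq L)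
    (F : seq L -> V) : (size u + size v = n)%N ->
  \sum_(a : {set 'I_n} | #|a| == size u)
     (-1) ^+ shuffle_perm a *: F (riffle (pattern a) u v) = shuf u v F.
Proof.
elim: n u v F => [|n IH] u v F.
  case: u v => [|//] [|//] _; rewrite (bigD1 finset.set0) ?cards0 //= big1 ?addr0.
    rewrite /pattern (_ : enum 'I_0 = [::]); last by apply: size0nil; rewrite size_enum_ord.
    rewrite (_ : shuffle_perm _ = 1%g) ?odd_perm1 ?scale1r //.
    by apply/permP => -[].
  by move=> a /andP[/eqP/cards0_eq -> /eqP].
move=> uvn; rewrite sum_shift_set.
rewrite (eq_bigl (fun a : {set 'I_n} => #|a|.+1 == size u)); last first.
  by move=> a; rewrite card_shift_set1.
rewrite [X in _ + X](eq_bigl (fun a : {set 'I_n} => #|a| == size u)); last first.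
  by move=> a; rewrite card_shift_set.
have s1 (a : {set 'I_n}) : shuffle_perm (ord0 |: shift_set a) = shuffle_perm a :> bool.
  by rewrite shuffle_perm_shift1 odd_lift_perm.
have s2 (a : {set 'I_n}) : shuffle_perm (shift_set a) = odd #|a| (+) shuffle_perm a :> bool.
  rewrite shuffle_perm_shift odd_lift_perm inordK ?addbF //.
  by rewrite ltnS -[X in (_ <= X)%N]card_ord max_card.
have sum1 u' a : size u = (size u').+1 ->
  \sum_(i : {set 'I_n} | #|i|.+1 == size u) (-1) ^+ shuffle_perm (ord0 |: shift_set i) *:
    F (a :: riffle (pattern i) u' v) = shuf u' v (fun w => F (a :: w)).
  move=> uE; rewrite -IH; last by apply/eq_add_S; rewrite -uvn uE.
  by rewrite uE; apply: eq_big => [//|i _]; rewrite s1.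
have sum2 v' b : size v = (size v').+1 ->
  \sum_(i : {set 'I_n} | #|i| == size u) (-1) ^+ shuffle_perm (shift_set i) *:
    F (b :: riffle (pattern i) u v') = (-1) ^+ size u *: shuf u v' (fun w => F (b :: w)).
  move=> vE; rewrite -IH; last by apply/eq_add_S; rewrite -uvn vE addnS.
  rewrite scaler_sumr; apply: eq_bigr => i /eqP <-.
  by rewrite s2 signr_addb scalerA signr_odd.
case: u uvn sum1 sum2 => [|a u] uvn sum1 sum2.
  rewrite big_pred0 // add0r; case: v uvn sum1 sum2 => [//|b v] uvn sum1 sum2.
  under eq_bigr do rewrite pattern_shift /=.
  by rewrite (sum2 v) //= scale1r.
under eq_bigr do rewrite pattern_shift1 /=.
rewrite (sum1 u) //.
case: v uvn sum1 sum2 => [|b v] uvn sum1 sum2.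
  rewrite big1 ?addr0 ?shufs0 // => i /eqP ia.
  suff: (#|i| <= n)%N by move: uvn; rewrite addn0 ia /= => -[->]; rewrite ltnn.
  by rewrite -[X in (_ <= X)%N](card_ord n) max_card.
under [X in _ + X]eq_bigr do rewrite pattern_shift /=.
by rewrite (sum2 v).
Qed.

(** * Simplices along words *)

Section Patterns.
Variables (n : nat) (a : {set 'I_n}).

Lemma size_pattern : size (pattern a) = n.
Proof. by rewrite size_map size_enum_ord. Qed.

Lemma cnt_pattern r : (r <= n)%N -> cnt a r = count id (take r (pattern a)).
Proof.
elim: r => [|r IH] rn; first by rewrite cnt0 take0.
rewrite cntS IH ?(ltnW rn) // (take_nth false) ?size_pattern // -cats1 count_cat /= addn0.
congr (_ + nat_of_bool _)%N.
rewrite /pattern (nth_map (Ordinal rn)) ?size_enum_ord //.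
rewrite (nth_ord_enum (Ordinal rn) (Ordinal rn)).
apply/mapP/idP => [[i]|ra]; last by exists (Ordinal rn); rewrite ?mem_enum.
by rewrite mem_enum => ia rE; rewrite (_ : Ordinal rn = i) //; apply: val_inj.
Qed.

Lemma cntC_pattern r : (r <= n)%N -> cnt (~: a) r = count negb (take r (pattern a)).
Proof.
move=> rn; apply: (@addnI (cnt a r)); rewrite cntC // cnt_pattern //.
by rewrite -[LHS](size_takel (s := pattern a)) ?size_pattern // -(count_predC id).
Qed.

End Patterns.

Lemma size_riffle (T : Type) b (u v : seq T) :
  (count id b <= size u)%N -> (count negb b <= size v)%N -> size (riffle b u v) = size b.
Proof.
elim: b u v => [//|[] b IH] [|x u] [|y v] //=; rewrite ?add0n ?add1n ?ltnS => ? ?;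
  by rewrite IH.
Qed.

Lemma sum_take_riffle (T : Type) (M : nmodType) (f : T -> M) b (u v : seq T) j :
  (count id b <= size u)%N -> (count negb b <= size v)%N ->
  \sum_(l <- take j (riffle b u v)) f l =
  \sum_(l <- take (count id (take j b)) u) f l
  + \sum_(l <- take (count negb (take j b)) v) f l.
Proof.
elim: b u v j => [|c b IH] u v [|j]; rewrite ?take0 ?big_nil ?addr0 //=.
case: c => /=; rewrite ?add0n ?add1n.
  by case: u => [//|x u] ub vb; rewrite !big_cons IH // addrA.
by case: v => [//|y v] ub vb; rewrite !big_cons IH // addrCA.
Qed.

Section Tracks.
Variables (L : Type) (S : sset) (M : nmodType).
Implicit Types (u v w : seq L).

(** W w stands for the simplex along the lattice path w, where a letter l moves by
    f l. It is characterised by naturality: pulling it back along h gives the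
    simplex along any v that visits, in order, the points of w selected by h. In
    this form the notion passes to products and refers to no base simplex. *)
Definition tracks (W : forall w, S (size w)) (f : L -> M) :=
  forall v w (h : dhom (size v) (size w)),
    (forall j : 'I_(size v).+1,
      \sum_(l <- take j v) f l = \sum_(l <- take (h j) w) f l) ->
    sact h (W w) = W v.

Lemma tracksE W f n v w (h : dhom n (size w)) : tracks W f -> n = size v ->
    (forall j : 'I_n.+1, \sum_(l <- take j v) f l = \sum_(l <- take (h j) w) f l) ->
  existT S n (sact h (W w)) = existT S (size v) (W v).
Proof. by move=> Wf nv; move: h; rewrite nv => h hE; rewrite Wf. Qed.

End Tracks.

(** Such a word repeats a vertex at the step 0, and W w is the degeneracy of the
    simplex along the word with this letter removed. *)
Lemma tracks_degenerate (L : nmodType) (S : sset) (M : nmodType)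
    (W : forall w : seq L, S (size w)) (f : L -> M) w :
  tracks W f -> f 0 = 0 -> 0 \in w -> degenerate (existT S (size w) (W w)).
Proof.
move=> Wf f0 /splitPr[w1 w2].
exists (size (w1 ++ w2)), (inord (size w1)), (W (w1 ++ w2)).
apply/esym; apply: tracksE Wf _ _ => [|j]; first by rewrite !size_cat addnS.
rewrite ffunE /= inordK ?size_cat ?ltnS ?leq_addr // /unbump !take_cat.
have [j1|j1] := ltnP (size w1) j; last first.
  rewrite subn0; case: ltnP => // j2; have -> : nat_of_ord j = size w1.
    by apply/eqP; rewrite eqn_leq j1.
  by rewrite subnn !take0.
rewrite ltnNge (ltnW j1) /= subn1 -ltnS (ltn_predK j1) ltnS leqNgt j1 /=.
rewrite !big_cat; congr (_ + _).
have -> : (j - size w1 = (j.-1 - size w1).+1)%N by lia.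
by rewrite /= big_cons f0 add0r.
Qed.

Lemma tracks_pair (L : Type) (S T : sset) (M M' : nmodType)
    (U : forall w : seq L, S (size w)) (V : forall w : seq L, T (size w))
    (f : L -> M) (g : L -> M') :
  tracks U f -> tracks V g ->
  tracks (S := sprod S T) (fun w => (U w, V w)) (fun l => (f l, g l)).
Proof.
move=> Uf Vg v w h hE /=; congr (_, _).
  apply: Uf => j; have := congr1 fst (hE j).
  by rewrite !(big_morph fst (id1 := 0) (op1 := +%R)).
apply: Vg => j; have := congr1 snd (hE j).
by rewrite !(big_morph snd (id1 := 0) (op1 := +%R)).
Qed.

Section Walk.
Variables (L : Type) (X : sset) (x : simp X) (c : L -> nat).
Local Open Scope nat_scope.

(** The truncation at tag x only makes the function total. *)
Definition walk_pos (w : seq L) (j : nat) : nat := minn (tag x) (\sum_(l <- take j w) c l).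

Lemma walk_pos_mono w (i j : 'I_(size w).+1) : i <= j ->
  (inord (walk_pos w i) : 'I_(tag x).+1) <= (inord (walk_pos w j) : 'I_(tag x).+1).
Proof.
move=> ij; rewrite !inordK ?ltnS ?geq_minl // leq_min geq_minl /=.
apply: leq_trans (geq_minr _ _) _.
by rewrite -(subnKC ij) takeD big_cat leq_addr.
Qed.

Definition walk (w : seq L) : X (size w) :=
  sact (DHom (monobP (@walk_pos_mono w))) (tagged x).

Lemma walk_tracks : tracks walk c.
Proof.
move=> v w h hE; rewrite /walk -sact_comp; congr (sact _ _); apply: dhom_eq => j.
by rewrite !ffunE !inordK ?ltnS ?geq_minl // /walk_pos hE.
Qed.

Lemma walk_pullback w : pullback x (walk_pos w) (size w) (existT X (size w) (walk w)).
Proof.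
by eexists; first reflexivity; move=> j; rewrite ffunE inordK // ltnS geq_minl.
Qed.

Lemma walk_nseq l : c l = 1 -> let w := nseq (tag x) l in existT X (size w) (walk w) = x.
Proof.
move=> cl w; have sw : size w = tag x by rewrite size_nseq.
apply: (pullback_uniq (g := id) (n := tag x) _ (pullback_id x)).
apply: (pullback_ext (g := walk_pos w)); last by rewrite -{1}sw; apply: walk_pullback.
move=> j jx; rewrite /walk_pos take_nseq // big_nseq cl.
rewrite (_ : iter _ _ _ = j); first by apply/minn_idPr.
by elim: {jx} j => //= j ->.
Qed.
End Walk.

(** * The shuffle map and the homotopy along words *)

Lemma sum_take0 (L : eqType) (M : nmodType) (h : L -> M) (s : seq L) j :
  {in s, forall l, h l = 0} -> \sum_(l <- take j s) h l = 0.
Proof. by move=> s0; rewrite big_seq big1 // => l /mem_take; apply: s0. Qed.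

Section PairPaths.
Variables (k : comPzRingType) (L : nmodType) (S T : sset) (M M' : nmodType).
Variables (U : forall w : seq L, S (size w)) (V : forall w : seq L, T (size w)).
Variables (f : L -> M) (g : L -> M').
Hypotheses (Uf : tracks U f) (Vg : tracks V g).
Implicit Types (u v w : seq L).

Definition pair_path w : chain k (sprod S T) :=
  @cgen k (sprod S T) (existT (sprod S T) (size w) (U w, V w)).

(** In a riffle of u and v only the letters of u move the first factor and only
    those of v the second one, so the vertex maps are the counting functions of
    the shuffle set and of its complement. *)
Lemma nabla_path u v :
  {in u, forall l, g l = 0} -> {in v, forall l, f l = 0} ->
  nabla k S T (tens (cgen k (existT S (size u) (U u))) (cgen k (existT T (size v) (V v)))) =
  shuf u v pair_path.
Proof.
move=> u0 v0; rewrite nablaE /nabla_gen /= -(sum_shuffles _ erefl).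
apply: eq_bigr => a /eqP ua; congr (_ *: _).
set b := pattern a.
have ub : count id b = size u.
  by rewrite -ua -cnt_full cnt_pattern // -{1}(size_pattern a) take_size.
have vb : count negb b = size v.
  have va : #|~: a| = size v by apply: (@addnI (size u)); rewrite -{1}ua cardsC card_ord.
  by rewrite -va -cnt_full cntC_pattern // -{1}(size_pattern a) take_size.
have sr : (size u + size v)%N = size (riffle b u v).
  by rewrite size_riffle ?ub ?vb // size_pattern.
have sumr (M0 : nmodType) (h : L -> M0) j : (j <= size u + size v)%N ->
    \sum_(l <- take j (riffle b u v)) h l =
    \sum_(l <- take (cnt a j) u) h l + \sum_(l <- take (cnt (~: a) j) v) h l.
  by move=> jn; rewrite sum_take_riffle ?ub ?vb // cnt_pattern // cntC_pattern.
have [h /= -> hE] := nabla_pullback1 (x := existT S _ (U u)) (y := existT T _ (V v)) ua.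
have [h' /= -> h'E] := nabla_pullback2 (x := existT S _ (U u)) (y := existT T _ (V v)) ua.
rewrite (tracksE Uf sr) => [|j]; last first.
  by rewrite hE sumr ?[X in _ + X]sum_take0 ?addr0 // -ltnS.
rewrite (tracksE Vg sr) => [|j]; last first.
  by rewrite h'E sumr ?[X in X + _]sum_take0 ?add0r // -ltnS.
exact: cpairE.
Qed.

(** The first factor sees exactly the phi-part of a letter, the second one
    exactly its psi-part. *)
Variables (phi psi : L -> L).
Hypotheses (f0 : f 0 = 0) (fD : {morph f : l l' / l + l'}) (f_phi : forall l, f (phi l) = f l)
  (f_psi : forall l, f (psi l) = 0).
Hypotheses (g0 : g 0 = 0) (gD : {morph g : l l' / l + l'}) (g_phi : forall l, g (phi l) = 0)
  (g_psi : forall l, g (psi l) = g l).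

Let f_jump w : f (jump psi w) = 0.
Proof. by rewrite (big_morph f fD f0) big1. Qed.

Let g_jump w : g (jump psi w) = \sum_(l <- w) g l.
Proof. by rewrite (big_morph g gD g0); apply: eq_bigr. Qed.

Lemma pair_path0 w : 0 \in w -> pair_path w = 0.
Proof.
move=> w0; apply: cgen_degenerate.
by apply: (tracks_degenerate (tracks_pair Uf Vg) _ w0); rewrite f0 g0.
Qed.

(** The term of the homotopy with indices p, q corresponds to the cut of w into
    pieces of sizes m - 1, p + 1 and q. The first factor rests while the second one
    jumps across w2; then the p + 1 steps of the first factor along w2 are
    interleaved with the q steps of the second factor along w3. *)
Section Term.
Variables (w1 w2 w3 : seq L) (p q : nat) (a : {set 'I_(p.+1 + q)}).
Hypotheses (ap : #|a| = p.+1) (w2p : size w2 = p.+1) (w3q : size w3 = q).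
Let w := w1 ++ w2 ++ w3.
Let n := size w.
Let b := pattern a.
Let r := w1 ++ jump psi w2 :: riffle b (map phi w2) (map psi w3).

Let nE : n = (size w1 + (p.+1 + q))%N.
Proof. by rewrite /n !size_cat w2p w3q. Qed.

Let pq : (p + q < n)%N.
Proof. by rewrite nE addSn leq_addl. Qed.

Let mE : (n - p - q = (size w1).+1)%N.
Proof. by rewrite nE; lia. Qed.

Let b1 : count id b = size (map phi w2).
Proof. by rewrite size_map w2p -ap -cnt_full cnt_pattern // -{1}(size_pattern a) take_size. Qed.

Let b2 : count negb b = size (map psi w3).
Proof.
rewrite size_map w3q -(EMH_card ap) -cnt_full cntC_pattern // -{1}(size_pattern a).
by rewrite take_size.
Qed.

Let size_r : n.+1 = size r.
Proof. by rewrite /r size_cat /= size_riffle ?b1 ?b2 // size_pattern nE addnS. Qed.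

Let sum_r_small (M0 : nmodType) (h : L -> M0) j : (j < (size w1).+1)%N ->
  \sum_(l <- take j r) h l = \sum_(l <- take j w) h l.
Proof. by move=> j1; rewrite /r /w !takel_cat. Qed.

Let sum_r_large (M0 : nmodType) (h : L -> M0) j : (size w1 < j <= n.+1)%N ->
  let i := (j - (size w1).+1)%N in
  \sum_(l <- take j r) h l = \sum_(l <- w1) h l + (h (jump psi w2)
   + (\sum_(l <- take (cnt a i) w2) h (phi l) + \sum_(l <- take (cnt (~: a) i) w3) h (psi l))).
Proof.
case/andP=> j1 jn i; have iN : (i <= p.+1 + q)%N by rewrite /i; move: jn; rewrite nE; lia.
rewrite /r take_cat ltnNge (ltnW j1) /= (_ : (j - size w1 = i.+1)%N); last by rewrite /i; lia.
rewrite big_cat /= big_cons sum_take_riffle ?b1 ?b2 //.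
by rewrite /b -cnt_pattern // -cntC_pattern // -!map_take !big_map.
Qed.

Lemma EMH_fst_path :
  EMH_fst n a (existT S n (U w)) = existT S (size r) (U r).
Proof.
have [h /= -> hE] := EMH_pullback1 pq ap (x := existT S n (U w)) erefl.
apply: tracksE Uf size_r _ => j; rewrite {}hE mE.
have [j1|j1] := ltnP j (size w1).+1; first exact: sum_r_small.
have jn : (j <= n.+1)%N := ltn_ord j.
rewrite sum_r_large ?j1 ?jn // f_jump add0r [X in _ + (_ + X)]big1 // addr0.
rewrite subn1 /= takeD -/w big_cat /w take_size_cat // drop_size_cat //; congr (_ + _).
rewrite takel_cat; last by rewrite w2p; apply: cnt_le.
by apply: eq_bigr.
Qed.

Lemma EMH_snd_path :
  EMH_snd n a (existT T n (V w)) = existT T (size r) (V r).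
Proof.
have [h /= -> hE] := EMH_pullback2 pq ap (y := existT T n (V w)) erefl.
apply: tracksE Vg size_r _ => j; rewrite {}hE mE.
have [j1|j1] := ltnP j (size w1).+1; first exact: sum_r_small.
have jn : (j <= n.+1)%N := ltn_ord j.
rewrite sum_r_large ?j1 ?jn // g_jump [X in _ + (_ + (X + _))]big1 // add0r.
rewrite [((size w1).+1 + p)%N]addSnnS takeD big_cat /w catA take_size_cat ?drop_size_cat
  ?size_cat ?w2p //.
by rewrite big_cat addrA; congr (_ + _); apply: eq_bigr.
Qed.
End Term.

(** The sums over p, q and over the two cut points are matched by i = n - q and
    j = n - q - p - 1 for the ends of w12 and of w1; the cuts with i = 0 or j = i,
    which have no p, q, are those with an empty jump. *)
Lemma EMH_path w :
  EMH k S T (pair_path w) = word_homotopy phi psi pair_path w.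
Proof.
rewrite EMHE /EMH_gen /=; set n := size w.
pose E i j := (-1) ^+ j *: shuf (map phi (drop j (take i w))) (map psi (drop i w))
  (fun t => pair_path (take j w ++ jump psi (drop j (take i w)) :: t)).
transitivity (\sum_(p < n) \sum_(q < n | (p + q < n)%N) E (n - q)%N (n - q - p.+1)%N).
  apply: eq_bigr => p _; apply: eq_bigr => q pq.
  set w1 := take (n - q - p.+1) w; set w2 := drop (n - q - p.+1) (take (n - q) w).
  set w3 := drop (n - q) w.
  have wE : w = w1 ++ w2 ++ w3.
    rewrite catA /w1 /w2 -(take_takel w (leq_subr p.+1 (n - q)%N)).
    by rewrite !cat_take_drop.
  have s2 : size w2 = p.+1 by rewrite size_drop size_takel -?/n; lia.
  have s3 : size w3 = q by rewrite size_drop -/n; lia.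
  have s1 : (n - p - q = (size w1).+1)%N by rewrite size_takel -?/n; lia.
  rewrite /E -/w1 -/w2 -/w3 -(sum_shuffles (n := p.+1 + q)) ?size_map ?s2 ?s3 //.
  rewrite scaler_sumr; apply: eq_bigr => a /eqP ap.
  have := EMH_fst_path w1 ap s2 s3; have := EMH_snd_path w1 ap s2 s3.
  rewrite -wE -/n => -> ->; rewrite /simp_fst cpairE scalerA -exprD; congr (_ *: _).
  have -> : (n - q - p.+1)%N = size w1 by rewrite size_takel -?/n; lia.
  by apply: sign_odd; rewrite s1 addn1 !oddD /= negbK.
rewrite (exchange_big_dep xpredT) //= /word_homotopy /cuts -/n.
(* The cut with i = 0 has an empty w12, hence an empty jump. *)
rewrite [RHS]big_ord_recl [X in _ = X + _]big1 ?add0r; last first.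
  move=> [i /= _] _; rewrite take0 drop_oversize // shuf0 ?scaler0 // => t _; apply: pair_path0.
  by rewrite mem_cat inE /jump big_nil eqxx orbT.
rewrite [RHS](reindex_inj rev_ord_inj) /=; apply: eq_bigr => q _.
rewrite (_ : bump 0 (n - q.+1) = (n - q)%N); last by rewrite /bump; have := ltn_ord q; lia.
(* For each remaining i = n - q, the cut with j = i has an empty w2. *)
rewrite size_takel ?leq_subr // [RHS]big_ord_recr [X in _ = _ + X]/=.
rewrite [X in _ = _ + X](_ : _ = 0) ?addr0; last first.
  rewrite (drop_oversize (s := take _ _)) ?size_take_min ?geq_minl //=.
  by rewrite pair_path0 ?scaler0 // mem_cat inE /jump big_nil eqxx orbT.
rewrite [RHS](reindex_inj rev_ord_inj) /=.
rewrite [RHS](eq_bigr (fun i : 'I_(n - q) => E (n - q)%N (n - q - i.+1)%N)); last first.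
  move=> i _; rewrite /E take_takel ?leq_subr // size_takel //.
  by apply: leq_trans (leq_subr _ _) (leq_subr _ _).
rewrite [RHS](big_ord_widen n (fun i => E (n - q)%N (n - q - i.+1)%N)) ?leq_subr //.
by apply: eq_bigl => i; rewrite ltn_subRL addnC.
Qed.
End PairPaths.

(** * The identities *)

Section WordHomotopyFunctional.
Variables (k : comPzRingType) (L : nmodType) (phi psi : L -> L).

Lemma linear_word_homotopy (V V' : lmodType k) (h : {linear V -> V'}) (G : seq L -> V) w :
  h (word_homotopy phi psi G w) = word_homotopy phi psi (fun t => h (G t)) w.
Proof.
rewrite /word_homotopy /cuts linear_sum; apply: eq_bigr => i _.
by rewrite linear_sum; apply: eq_bigr => j _; rewrite linearZ linear_shuf.
Qed.

(** All letters of the words produced from w are sums of parts of letters of w,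
    so a coordinate f that vanishes on w vanishes on them. *)
Lemma eq_word_homotopy (V : lmodType k) (M : nmodType) (f : L -> M) (G G' : seq L -> V) w :
  f 0 = 0 -> {morph f : l l' / l + l'} ->
  (forall l, f l = 0 -> f (phi l) = 0) -> (forall l, f l = 0 -> f (psi l) = 0) ->
  {in w, forall l, f l = 0} ->
  (forall t, {in t, forall l, f l = 0} -> G t = G' t) ->
  word_homotopy phi psi G w = word_homotopy phi psi G' w.
Proof.
move=> f0 fD fphi fpsi fw GG'; apply: eq_cuts => w12 w3 wE; apply: eq_cuts => w1 w2 w12E.
congr (_ *: _); apply: eq_shuf => t tE; apply: GG' => l.
have fw' s : {subset s <= w} -> {in s, forall l, f l = 0} by move=> sw m /sw; apply: fw.
have f1 : {in w1, forall l, f l = 0}.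
  by apply: fw' => m m1; rewrite wE w12E !mem_cat m1.
have f2 : {in w2, forall l, f l = 0}.
  by apply: fw' => m m2; rewrite wE w12E !mem_cat m2 orbT.
have f3 : {in w3, forall l, f l = 0}.
  by apply: fw' => m m3; rewrite wE w12E !mem_cat m3 !orbT.
rewrite mem_cat inE (perm_mem tE) mem_cat.
case/or4P=> [/f1 //|/eqP ->|/mapP[m /f2 ? ->]|/mapP[m /f3 ? ->]].
- by rewrite (big_morph f fD f0) big_seq big1 // => m /f2; apply: fpsi.
- exact: fphi.
- exact: fpsi.
Qed.

End WordHomotopyFunctional.

Section TensorLinear.
Variables (k : comPzRingType) (A B : lmodType k).

(** Partial applications of the tensor, named to carry their linearity. *)
Definition tens_at (v : B) : A -> tensor A B := fun u => tens u v.
Lemma tens_at_linear v : linear (tens_at v).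
Proof. by move=> a u u'; apply: tensDl. Qed.
HB.instance Definition _ v := GRing.isLinear.Build k A (tensor A B) _ _ (tens_at_linear v).

Definition tens_to (u : A) : B -> tensor A B := tens u.
Lemma tens_to_linear u : linear (tens_to u).
Proof. by move=> a v v'; apply: tensDr. Qed.
HB.instance Definition _ u := GRing.isLinear.Build k B (tensor A B) _ _ (tens_to_linear u).

End TensorLinear.

Lemma tensor_chain_ext (k : comPzRingType) (X Y : sset) (V : lmodType k)
    (f g : {linear tensor (chain k X) (chain k Y) -> V}) :
  (forall x y, f (tens (cgen k x) (cgen k y)) = g (tens (cgen k x) (cgen k y))) -> f =1 g.
Proof.
move=> fg; apply: tensor_ext => c d.
apply: (chain_ext (f := f \o tens_at d) (g := g \o tens_at d)) => x.
by apply: (chain_ext (f := f \o tens_to _) (g := g \o tens_to _)) => y; apply: fg.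
Qed.

HB.instance Definition _ (k : comPzRingType) (X X' Y Y' : sset) (d : nat)
    (f : {linear chain k X -> chain k X'}) (g : {linear chain k Y -> chain k Y'}) :=
  GRing.Linear.copy (ktens d f g) (tens_map (f \o csign d) g).

Lemma eq_walk (L : eqType) (X : sset) (x : simp X) (c c' : L -> nat) w :
  {in w, c =1 c'} -> walk x c w = walk x c' w.
Proof.
move=> cc'; congr (sact _ _); apply: dhom_eq => j; rewrite !ffunE /walk_pos.
by congr (nat_of_ord (inord (minn _ _))); apply: eq_big_seq => l /mem_take; apply: cc'.
Qed.

Lemma walk_sprod (L : Type) (X Y : sset) (s : simp (sprod X Y)) (c : L -> nat) w :
  walk s c w = (walk (simp_fst s) c w, walk (simp_snd s) c w).
Proof.
by congr (_, _); congr (sact _ _); apply: dhom_eq => j; rewrite !ffunE.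
Qed.

Lemma walk_pair_nseq (L : eqType) (X Y : sset) (s : simp (sprod X Y)) (c c' : L -> nat) l :
  c l = 1%N -> c' l = 1%N -> let w := nseq (tag s) l in
  existT (sprod X Y) (size w) (walk (simp_fst s) c w, walk (simp_snd s) c' w) = s.
Proof.
move=> cl c'l w; rewrite (@eq_walk _ Y _ c' c) => [|m /nseqP[-> _]]; last by rewrite cl.
by rewrite -walk_sprod; apply: walk_nseq.
Qed.

Definition step : Type := (nat * nat * nat)%type.
HB.instance Definition _ := GRing.Nmodule.on step.

Section Steps.
Implicit Types (l : step).

Definition step_x l : nat := l.1.1.
Definition step_y l : nat := l.1.2.
Definition step_z l : nat := l.2.

Definition dir_x l : step := (step_x l, 0, 0)%N.
Definition dir_z l : step := (0, 0, step_z l)%N.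
Definition dir_xy l : step := (step_x l, step_y l, 0)%N.
Definition dir_yz l : step := (0, step_y l, step_z l)%N.
End Steps.

(** The first generator is the walk along a word of x-steps, the second one along
    a word of diagonal steps of y and z; the former have no z-part, so the homotopy
    that separates z passes through the shuffle product with them. *)
Lemma EMH_nabla_right (k : comPzRingType) (X Y Z : sset) (s : simp X) (t : simp (sprod Y Z)) :
  EMH k (sprod X Y) Z (cmap k (sassoc X Y Z)
    (nabla k X (sprod Y Z) (tens (cgen k s) (cgen k t)))) =
  cmap k (sassoc X Y Z) (nabla k X (sprod Y Z)
    (ktens 1 idfun (EMH k Y Z) (tens (cgen k s) (cgen k t)))).
Proof.
pose U := walk s step_x; pose V := walk (simp_fst t) step_y; pose W := walk (simp_snd t) step_z.
have Ut : tracks U step_x by apply: walk_tracks.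
have Vt : tracks V step_y by apply: walk_tracks.
have Wt : tracks W step_z by apply: walk_tracks.
pose u : seq step := nseq (tag s) (1, 0, 0)%N; pose v : seq step := nseq (tag t) (0, 1, 1)%N.
have uE : existT X (size u) (U u) = s by apply: walk_nseq.
have vE : existT (sprod Y Z) (size v) (V v, W v) = t by apply: walk_pair_nseq.
have nabla_walk w : {in w, forall l, step_x l = 0} ->
    cmap k (sassoc X Y Z) (nabla k X (sprod Y Z) (tens (cgen k s) (pair_path k V W w))) =
    shuf u w (pair_path k (S := sprod X Y) (fun w => (U w, V w)) W).
  move=> wx; rewrite -uE (nabla_path k Ut (tracks_pair Vt Wt)) => [|l /nseqP[-> _]//|//].
  rewrite linear_shuf; apply: eq_shuf => r _; exact: cliftE.
have su : size u = tag s by rewrite size_nseq.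
have pE : pair_path k V W v = cgen k t by rewrite /pair_path vE.
rewrite ktensE mul1n -pE nabla_walk => [|l /nseqP[-> _]//].
rewrite !linearZ /= (EMH_path k Vt Wt (phi := dir_xy) (psi := dir_z)) //.
have := linear_word_homotopy dir_xy dir_z
  (cmap k (sassoc X Y Z) \o nabla k X (sprod Y Z) \o tens_to (cgen k s)) (pair_path k V W) v.
rewrite [LHS]/= /tens_to => ->.
rewrite linear_shuf.
rewrite (eq_shuf (F' := word_homotopy dir_xy dir_z
  (pair_path k (S := sprod X Y) (fun w => (U w, V w)) W))); last first.
  by move=> w _; apply: (EMH_path k (tracks_pair Ut Vt) Wt).
rewrite shuf_word_homotopyr; first last.
- by move=> l /nseqP[-> _].
- by move=> l /nseqP[-> _].
- by move=> w; apply: (pair_path0 k (tracks_pair Ut Vt) Wt).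
rewrite su; congr (_ *: _); apply/esym.
by apply: (@eq_word_homotopy _ _ _ _ _ _ step_x) => // l /nseqP[-> _].
Qed.

(** Here the first generator is the walk along diagonal steps of x and y, and the
    z-steps of the second one have no x-part. *)
Lemma EMH_nabla_left (k : comPzRingType) (X Y Z : sset) (s : simp (sprod X Y)) (t : simp Z) :
  EMH k X (sprod Y Z) (cmap k (sassocV X Y Z)
    (nabla k (sprod X Y) Z (tens (cgen k s) (cgen k t)))) =
  cmap k (sassocV X Y Z) (nabla k (sprod X Y) Z
    (ktens 0 (EMH k X Y) idfun (tens (cgen k s) (cgen k t)))).
Proof.
pose U := walk (simp_fst s) step_x; pose V := walk (simp_snd s) step_y; pose W := walk t step_z.
have Ut : tracks U step_x by apply: walk_tracks.
have Vt : tracks V step_y by apply: walk_tracks.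
have Wt : tracks W step_z by apply: walk_tracks.
pose u : seq step := nseq (tag s) (1, 1, 0)%N; pose v : seq step := nseq (tag t) (0, 0, 1)%N.
have uE : existT (sprod X Y) (size u) (U u, V u) = s by apply: walk_pair_nseq.
have vE : existT Z (size v) (W v) = t by apply: walk_nseq.
have nabla_walk w : {in w, forall l, step_z l = 0} ->
    cmap k (sassocV X Y Z) (nabla k (sprod X Y) Z (tens (pair_path k U V w) (cgen k t))) =
    shuf w v (pair_path k (T := sprod Y Z) U (fun w => (V w, W w))).
  move=> wz; rewrite -vE (nabla_path k (tracks_pair Ut Vt) Wt) => [|//|l /nseqP[-> _]//].
  rewrite linear_shuf; apply: eq_shuf => r _; exact: cliftE.
have pE : pair_path k U V u = cgen k s by rewrite /pair_path uE.
rewrite ktensE mul0n scale1r -pE nabla_walk => [|l /nseqP[-> _]//].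
rewrite /= (EMH_path k Ut Vt (phi := dir_x) (psi := dir_yz)) //.
have := linear_word_homotopy dir_x dir_yz
  (cmap k (sassocV X Y Z) \o nabla k (sprod X Y) Z \o tens_at (cgen k t)) (pair_path k U V) u.
rewrite [LHS]/= /tens_at => ->.
rewrite linear_shuf.
rewrite (eq_shuf (F' := word_homotopy dir_x dir_yz
  (pair_path k (T := sprod Y Z) U (fun w => (V w, W w))))); last first.
  by move=> w _; apply: (EMH_path k Ut (tracks_pair Vt Wt)).
rewrite shuf_word_homotopyl; first last.
- by move=> l /nseqP[-> _].
- by move=> l /nseqP[-> _].
- by move=> w; apply: (pair_path0 k Ut (tracks_pair Vt Wt)).
by apply/esym; apply: (@eq_word_homotopy _ _ _ _ _ _ step_z) => // l /nseqP[-> _].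
Qed.

Theorem proposition3p2 (k : comPzRingType) (X Y Z : sset) :
  (EMH k (sprod X Y) Z \o cmap k (sassoc X Y Z) \o nabla k X (sprod Y Z)
     =1 cmap k (sassoc X Y Z) \o nabla k X (sprod Y Z) \o ktens 1 idfun (EMH k Y Z))
  /\
  (EMH k X (sprod Y Z) \o cmap k (sassocV X Y Z) \o nabla k (sprod X Y) Z
     =1 cmap k (sassocV X Y Z) \o nabla k (sprod X Y) Z \o ktens 0 (EMH k X Y) idfun).
Proof.
split; apply: tensor_chain_ext => s t; first exact: EMH_nabla_right.
exact: EMH_nabla_left.
Qed.
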